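(* Let $K\ge 1$, let $\mathcal C$ be a set of choices with comparison set $\bar{\mathcal C}\subseteq\mathcal C$, both closed under randomization, and let $\ell:\mathcal C\to[0,1]^K$ be a group loss function with loss assessor $\ell_\tau$. Suppose that either (i) $f:[0,1]^K\to\mathbb R$ is Lipschitz continuous (with constant $1$) and $M_\tau$ is a linear optimizer; or (ii) $f:[0,1]^K\to\mathbb R$ is nondecreasing and Lipschitz continuous (with constant $1$) and $M_\tau$ is a nonnegative linear optimizer. Then for any $0<\epsilon\le 1$, the choice $c=\textsc{GroupOpt}(\epsilon,f,\ell_\tau,M_\tau)\in\mathcal C$ returned by the algorithm GroupOpt satisfies $$f(\ell(c))\le\min_{l\in\ell(\bar{\mathcal C})}f(l)+\epsilon .$$ Moreover, for constant $K$, GroupOpt makes $\mathrm{poly}(1/\epsilon)$ queries to $\ell_\tau$ and to $M_\tau$, both with $\tau=\frac{\epsilon^2}{25\sqrt K}$, and uses $\mathrm{poly}(1/\epsilon)$ additional runtime and calls to $f$.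
   Context: $\|\cdot\|$ is the Euclidean norm. $f$ is Lipschitz if $|f(x)-f(y)|\le\|x-y\|$ for all $x,y$ in its domain. $f$ is nondecreasing if it is nondecreasing in each coordinate. $\ell(S)=\{\ell(c):c\in S\}$. An inequality $X\le\min_{s\in S}\varphi(s)+a$ is to be read as: $X\le\varphi(s)+a$ for all $s\in S$. Closed under randomization: a set $\mathcal C$ of choices is closed under randomization if for every finite sequence $c_1,\dots,c_n\in\mathcal C$ there is an element of $\mathcal C$, denoted $\mathrm{UniformDist}(\{c_1,\dots,c_n\})$, with $\ell(\mathrm{UniformDist}(\{c_1,\dots,c_n\}))=\frac1n(\ell(c_1)+\dots+\ell(c_n))$ (a repeated element counts with multiplicity). A linear optimizer is a family of maps $M_\tau:\mathbb R^K\to\mathcal C$, $\tau>0$, such that for all $\tau>0$ and $w\in\mathbb R^K$, $w\cdot\ell(M_\tau(w))\le\min_{\bar c\in\bar{\mathcal C}}w\cdot\ell(\bar c)+\tau\|w\|$. A nonnegative linear optimizer is a family of maps $M_\tau:[0,\infty)^K\to\mathcal C$ such that the same inequality holds for all $w\ge 0$. A loss assessor is a family of maps $\ell_\tau:\mathcal C\to[0,1]^K$, $\tau>0$, with $\|\ell_\tau(c)-\ell(c)\|\le\tau$ for all $c\in\mathcal C$. Algorithm GroupOpt$(\epsilon,f,\ell_\tau,M_\tau)$. Set $\beta=\epsilon/5$, $q=\beta/\sqrt K$, $\tau=\beta^2/\sqrt K$, $T=\left\lceil\frac{K}{\beta^2}\ln\frac{K}{\beta^2}\right\rceil$, and $G=\{0,q,2q,\dots,\lfloor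 1/q\rfloor q\}^K\subseteq[0,1]^K$. Let $N=1$ if $f$ restricted to $G$ is coordinatewise nondecreasing, and $N=0$ otherwise. Visit the points $r\in G$ in increasing order of $f(r)$. For each visited $r$: let $c_1=M_\tau(0)$; for $t=1,\dots,T$ let $$\hat l_t=\max\Big(\tfrac1t\big(\ell_\tau(c_1)+\dots+\ell_\tau(c_t)\big),\,Nr\Big)\ \text{(coordinatewise maximum)},\qquad c_{t+1}=M_\tau(\hat l_t-r).$$ If $\|\hat l_T-r\|\le 3\beta$, return $\mathrm{UniformDist}(\{c_1,\dots,c_T\})$ and stop; otherwise go on to the next grid point. *)

(* Defs.v *)
From HB Require Import structures.
From mathcomp Require Import all_boot all_order all_algebra.
From mathcomp Require Import boolp classical_sets reals sequences exp.

Set Implicit Arguments.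
Unset Strict Implicit.
Unset Printing Implicit Defensive.

Import Order.TTheory GRing.Theory Num.Theory.

Local Open Scope classical_set_scope.
Local Open Scope ring_scope.

(* The norm that MathComp-Analysis puts on row vectors is the sup norm, so the
   Euclidean norm is defined here. *)
Definition euclid (R : realType) (K : nat) (v : 'rV[R]_K) : R :=
  Num.sqrt (\sum_(i < K) v 0 i ^+ 2).

Definition dot (R : realType) (K : nat) (v w : 'rV[R]_K) : R :=
  \sum_(i < K) v 0 i * w 0 i.

Definition cube (R : realType) (K : nat) : set 'rV[R]_K :=
  [set x | forall i, 0 <= x 0 i <= 1].

(* A function on the cube is represented by a total function, constrained only
   at points of the cube. *)
Definition lipschitz_on_cube (R : realType) (K : nat) (f : 'rV[R]_K -> R) :=
  forall x y : 'rV[R]_K, cube x -> cube y -> `|f x - f y| <= euclid (x - y).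

Definition nondecreasing_on_cube (R : realType) (K : nat)
    (f : 'rV[R]_K -> R) :=
  forall (x y : 'rV[R]_K) i, cube x -> cube y ->
    (forall j, j != i -> x 0 j = y 0 j) -> x 0 i <= y 0 i -> f x <= f y.

Section Choices.
Context (R : realType) (K : nat) (C : Type) (ell : C -> 'rV[R]_K).

Definition mean_loss (s : seq C) : 'rV[R]_K :=
  (size s)%:R^-1 *: \sum_(c <- s) ell c.

Definition closed_under_randomization (S : set C) :=
  forall n (c : n.+1.-tuple C), (forall i, S (tnth c i)) ->
    exists2 d, S d & ell d = mean_loss c.

(* [unif] is a choice of UniformDist(c_1, ..., c_n) for all finite sequences;
   its value at the empty sequence is irrelevant. *)
Definition uniform_dist (unif : seq C -> C) :=
  forall n (c : n.+1.-tuple C), ell (unif c) = mean_loss c.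

Definition linear_optimizer (Cbar : set C) (M : R -> 'rV[R]_K -> C) :=
  forall (tau : R) (w : 'rV[R]_K), 0 < tau -> forall cbar, Cbar cbar ->
    dot w (ell (M tau w)) <= dot w (ell cbar) + tau * euclid w.

(* The values of [M tau] outside the nonnegative orthant are unconstrained. *)
Definition nonneg_linear_optimizer (Cbar : set C) (M : R -> 'rV[R]_K -> C) :=
  forall (tau : R) (w : 'rV[R]_K), 0 < tau -> (forall i, 0 <= w 0 i) ->
    forall cbar, Cbar cbar ->
    dot w (ell (M tau w)) <= dot w (ell cbar) + tau * euclid w.

Definition loss_assessor (ellt : R -> C -> 'rV[R]_K) :=
  forall (tau : R) (c : C), 0 < tau ->
    cube (ellt tau c) /\ euclid (ellt tau c - ell c) <= tau.

End Choices.

(* Oracle programs on a real RAM. The type [V] of real registers and the type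
   [C] of choices are parameters: a program that is polymorphic in them can
   touch reals and choices only through instructions, each of which leaves a
   mark in the execution trace. [Tick] is used to charge list bookkeeping that
   is not accompanied by another instruction. *)
Inductive instr (V C : Type) : Type -> Type :=
| Tick : instr V C unit
| Nat : nat -> instr V C V
| Add : V -> V -> instr V C V
| Sub : V -> V -> instr V C V
| Mul : V -> V -> instr V C V
| Div : V -> V -> instr V C V
| Sqrt : V -> instr V C V
| Ln : V -> instr V C V
| Leq : V -> V -> instr V C bool
| Ceil : V -> instr V C nat
| Floor : V -> instr V C nat
| CallF : seq V -> instr V C V
| Assess : V -> C -> instr V C (seq V)
| Optimize : V -> seq V -> instr V C C
| Mix : seq C -> instr V C C.

Inductive prog (V C A : Type) : Type :=
| Ret of A
| Do X of instr V C X & (X -> prog V C A).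

Arguments Tick {V C}.
Arguments Nat {V C} _.
Arguments Add {V C} _ _.
Arguments Sub {V C} _ _.
Arguments Mul {V C} _ _.
Arguments Div {V C} _ _.
Arguments Sqrt {V C} _.
Arguments Ln {V C} _.
Arguments Leq {V C} _ _.
Arguments Ceil {V C} _.
Arguments Floor {V C} _.
Arguments CallF {V C} _.
Arguments Assess {V C} _ _.
Arguments Optimize {V C} _ _.
Arguments Mix {V C} _.
Arguments Ret {V C A} _.
Arguments Do {V C A X} _ _.

Fixpoint bind V C A B (p : prog V C A) (k : A -> prog V C B) : prog V C B :=
  match p with
  | Ret a => k a
  | Do _ i k' => Do i (fun x => bind (k' x) k)
  end.

Local Notation "'do' x <- i ; p" := (Do i (fun x => p))
  (at level 200, x name, i at level 100, p at level 200,
   format "'do'  x  <-  i ; '//' p").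
Local Notation "'run' x <- q ; p" := (bind q (fun x => p))
  (at level 200, x pattern, q at level 100, p at level 200,
   format "'run'  x  <-  q ; '//' p").

Section Semantics.
Context (R : realType) (K : nat) (C : Type).
Context (f : 'rV[R]_K -> R) (ellt : R -> C -> 'rV[R]_K).
Context (M : R -> 'rV[R]_K -> C) (unif : seq C -> C).

Definition row_of_seq (s : seq R) : 'rV[R]_K := \row_i s`_i.
Definition seq_of_row (v : 'rV[R]_K) : seq R := [seq v 0 i | i <- enum 'I_K].

(* [Ceil] and [Floor] are only meaningful at nonnegative arguments. *)
Definition answer X (i : instr R C X) : X :=
  match i in instr _ _ X return X with
  | Tick => tt
  | Nat n => n%:R
  | Add x y => x + y
  | Sub x y => x - y
  | Mul x y => x * y
  | Div x y => x / y
  | Sqrt x => Num.sqrt x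
  | Ln x => ln x
  | Leq x y => x <= y
  | Ceil x => `|Num.ceil x|%N
  | Floor x => `|Num.floor x|%N
  | CallF s => f (row_of_seq s)
  | Assess tau c => seq_of_row (ellt tau c)
  | Optimize tau s => M tau (row_of_seq s)
  | Mix s => unif s
  end.

Inductive event :=
| Work of nat
| CalledF
| Assessed of R
| Optimized of R.

(* Arithmetic, comparisons and bookkeeping cost one unit. Rounding a real to an
   integer n costs n + 1 units (as if by counting), and forming the uniform
   distribution over n choices costs n + 1 units. *)
Definition event_of X (i : instr R C X) : event :=
  match i with
  | Ceil x => Work `|Num.ceil x|%N.+1
  | Floor x => Work `|Num.floor x|%N.+1
  | Mix s => Work (size s).+1
  | CallF _ => CalledF
  | Assess tau _ => Assessed tau
  | Optimize tau _ => Optimized tau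
  | _ => Work 1
  end.

Fixpoint result A (p : prog R C A) : A :=
  match p with
  | Ret a => a
  | Do _ i k => result (k (answer i))
  end.

Fixpoint trace A (p : prog R C A) : seq event :=
  match p with
  | Ret _ => [::]
  | Do _ i k => event_of i :: trace (k (answer i))
  end.

End Semantics.

Definition runtime (R : realType) (tr : seq (event R)) : nat :=
  \sum_(e <- tr) (if e is Work n then n else 0).

Definition calls_f (R : realType) (tr : seq (event R)) : nat :=
  count (fun e => if e is CalledF then true else false) tr.

(* The accuracies tau with which the loss assessor, respectively the optimizer,
   was queried, one entry for each query. *)
Definition assessor_taus (R : realType) (tr : seq (event R)) : seq R :=
  pmap (fun e => if e is Assessed tau then Some tau else None) tr.

Definition optimizer_taus (R : realType) (tr : seq (event R)) : seq R :=
  pmap (fun e => if e is Optimized tau then Some tau else None) tr.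

Section GroupOpt.
Context (V C : Type).

Fixpoint vmap (op : V -> instr V C V) (xs : seq V) : prog V C (seq V) :=
  match xs with
  | [::] => Ret [::]
  | x :: xs =>
      do z <- op x;
      run zs <- vmap op xs;
      Ret (z :: zs)
  end.

Fixpoint vmap2 (op : V -> V -> instr V C V) (xs ys : seq V) :
    prog V C (seq V) :=
  match xs, ys with
  | x :: xs, y :: ys =>
      do z <- op x y;
      run zs <- vmap2 op xs ys;
      Ret (z :: zs)
  | _, _ => Ret [::]
  end.

Fixpoint vmax (xs ys : seq V) : prog V C (seq V) :=
  match xs, ys with
  | x :: xs, y :: ys =>
      do b <- Leq x y;
      run zs <- vmax xs ys;
      Ret ((if b then y else x) :: zs)
  | _, _ => Ret [::]
  end.

Fixpoint vzero (k : nat) : prog V C (seq V) :=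
  match k with
  | 0 => Ret [::]
  | k.+1 =>
      do z <- Nat 0;
      run zs <- vzero k;
      Ret (z :: zs)
  end.

Fixpoint sumsq (xs : seq V) : prog V C V :=
  match xs with
  | [::] => do z <- Nat 0; Ret z
  | x :: xs =>
      run s <- sumsq xs;
      do y <- Mul x x;
      do z <- Add y s;
      Ret z
  end.

Definition vnorm (xs : seq V) : prog V C V :=
  run s <- sumsq xs;
  do z <- Sqrt s;
  Ret z.

(* The list j q, (j + 1) q, ..., (j + n - 1) q. *)
Fixpoint axis (q : V) (j n : nat) : prog V C (seq V) :=
  match n with
  | 0 => Ret [::]
  | n.+1 =>
      do a <- Nat j;
      do x <- Mul a q;
      run xs <- axis q j.+1 n;
      Ret (x :: xs)
  end.

Fixpoint cons_all (x : V) (g acc : seq (seq V)) : prog V C (seq (seq V)) :=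
  match g with
  | [::] => Ret acc
  | v :: g =>
      do _ <- Tick;
      run rest <- cons_all x g acc;
      Ret ((x :: v) :: rest)
  end.

Fixpoint product (xs : seq V) (g : seq (seq V)) : prog V C (seq (seq V)) :=
  match xs with
  | [::] => Ret [::]
  | x :: xs =>
      do _ <- Tick;
      run acc <- product xs g;
      cons_all x g acc
  end.

Fixpoint grid (xs : seq V) (k : nat) : prog V C (seq (seq V)) :=
  match k with
  | 0 => Ret [:: [::]]
  | k.+1 =>
      do _ <- Tick;
      run g <- grid xs k;
      product xs g
  end.

Fixpoint tabulate (g : seq (seq V)) : prog V C (seq (seq V * V)) :=
  match g with
  | [::] => Ret [::]
  | r :: g =>
      do y <- CallF r;
      run rest <- tabulate g;
      Ret ((r, y) :: rest)
  end.

Fixpoint same (xs ys : seq V) : prog V C bool :=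
  match xs, ys with
  | x :: xs, y :: ys =>
      do a <- Leq x y;
      do b <- Leq y x;
      if a && b then same xs ys else Ret false
  | _, _ => Ret true
  end.

(* Decides whether ys is obtained from xs by raising at most one coordinate. *)
Fixpoint raised (xs ys : seq V) : prog V C bool :=
  match xs, ys with
  | x :: xs, y :: ys =>
      do a <- Leq x y;
      do b <- Leq y x;
      if a then if b then raised xs ys else same xs ys else Ret false
  | _, _ => Ret true
  end.

Fixpoint mono_from (x : seq V * V) (t : seq (seq V * V)) : prog V C bool :=
  match t with
  | [::] => Ret true
  | y :: t =>
      do _ <- Tick;
      run a <- raised x.1 y.1;
      do b <- Leq x.2 y.2;
      if a ==> b then mono_from x t else Ret false
  end.

Fixpoint mono (t' t : seq (seq V * V)) : prog V C bool :=
  match t' with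
  | [::] => Ret true
  | x :: t' =>
      do _ <- Tick;
      run b <- mono_from x t;
      if b then mono t' t else Ret false
  end.

(* Insertion sort by the value of f. Points with equal values are ordered by
   [tie]; as [tie] ranges over all boolean relations, every order of the grid in
   which f is nondecreasing is obtained. *)
Fixpoint insert (tie : seq V -> seq V -> bool) (x : seq V * V)
    (t : seq (seq V * V)) : prog V C (seq (seq V * V)) :=
  match t with
  | [::] => Ret [:: x]
  | y :: t' =>
      do a <- Leq x.2 y.2;
      do b <- Leq y.2 x.2;
      do _ <- Tick;
      if a && (b ==> tie x.1 y.1) then Ret (x :: t)
      else run rest <- insert tie x t'; Ret (y :: rest)
  end.

Fixpoint sort_by_value (tie : seq V -> seq V -> bool) (t : seq (seq V * V)) :
    prog V C (seq (seq V * V)) :=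
  match t with
  | [::] => Ret [::]
  | x :: t =>
      do _ <- Tick;
      run s <- sort_by_value tie t;
      insert tie x s
  end.

(* Rounds t + 1, ..., t + n at the grid point r, where c = c_(t+1), S is the sum
   of the assessed losses of c_1, ..., c_t and lhat is the vector of round t.
   Returns the last vector lhat and the list c_(t+1), ..., c_(t+n). *)
Fixpoint play (tau N : V) (r : seq V) (t n : nat) (c : C) (S lhat : seq V) :
    prog V C (seq V * seq C) :=
  match n with
  | 0 => Ret (lhat, [::])
  | n.+1 =>
      do l <- Assess tau c;
      run S <- vmap2 Add S l;
      do t' <- Nat t.+1;
      run avg <- vmap (fun x => Div x t') S;
      run Nr <- vmap (Mul N) r;
      run lhat <- vmax avg Nr;
      run w <- vmap2 Sub lhat r;
      do c' <- Optimize tau w;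
      run res <- play tau N r t.+1 n c' S lhat;
      Ret (res.1, c :: res.2)
  end.

Fixpoint visit (K T : nat) (beta tau N : V) (pts : seq (seq V * V)) :
    prog V C (option C) :=
  match pts with
  | [::] => Ret None
  | (r, _) :: pts =>
      run z <- vzero K;
      do c1 <- Optimize tau z;
      run res <- play tau N r 0 T c1 z z;
      run v <- vmap2 Sub res.1 r;
      run d <- vnorm v;
      do three <- Nat 3;
      do bound <- Mul three beta;
      do ok <- Leq d bound;
      if ok then do c <- Mix res.2; Ret (Some c)
      else visit K T beta tau N pts
  end.

(* The result is [None] if every grid point is rejected. *)
Definition GroupOpt (K : nat) (tie : seq V -> seq V -> bool) (eps : V) :
    prog V C (option C) :=
  do five <- Nat 5;
  do beta <- Div eps five;
  do k <- Nat K;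
  do sqrtk <- Sqrt k;
  do q <- Div beta sqrtk;
  do beta2 <- Mul beta beta;
  do tau <- Div beta2 sqrtk;
  do kb <- Div k beta2;
  do lnkb <- Ln kb;
  do rounds <- Mul kb lnkb;
  do T <- Ceil rounds;
  do one <- Nat 1;
  do qinv <- Div one q;
  do m <- Floor qinv;
  run xs <- axis q 0 m.+1;
  run g <- grid xs K;
  run tbl <- tabulate g;
  run b <- mono tbl tbl;
  do N <- Nat b;
  run pts <- sort_by_value tie tbl;
  visit K T beta tau N pts.

End GroupOpt.

(* Main.v *)
(** Fix a grid point [r] and let [g_t = t (lhat_t - r)]. Coordinatewise
    [|g_(t+1)| <= |g_t + u|], where [u] is the assessed loss of [c_(t+1)] minus
    [r]. If some comparison loss is within [beta] of [r], the optimizer forces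
    [g_t . u <= a |g_t|] with [a = beta + 2 tau], so
    [|g_(t+1)|^2 <= |g_t|^2 + 2 a |g_t| + K] and [|g_T| <= a T + sqrt (K T)]; the
    choice of [T] makes this at most [3 beta T], and [r] is accepted. Hence the
    first accepted grid point [r] has [f r <= f l + beta] for every comparison
    loss [l].

    For an accepted [r], it remains to bound [f] at the mean loss [y]. If [N = 1],
    then [f] is only known to be monotone on the grid, and rounding [y] down to
    the grid would cost [beta], which is slightly too much. Instead, move from [y]
    to [min (y, r)], at distance at most [3 beta]; since [r] is a grid point,
    [min (y, r)] can be rounded to the nearest multiples of [q] without leaving
    the region below [r], at cost [beta / 2]. *)
Require Import Defs.
From mathcomp Require Import all_boot all_order all_algebra.
From mathcomp Require Import boolp classical_sets reals sequences exp.
From mathcomp Require Import zify ring lra.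

Set Implicit Arguments.
Unset Strict Implicit.
Unset Printing Implicit Defensive.

Import Order.TTheory GRing.Theory Num.Theory.

Local Open Scope classical_set_scope.
Local Open Scope ring_scope.

(** * Euclidean inner product and norm on row vectors *)

Section Euclid.
Context (R : realType) (K : nat).
Implicit Types (v w x : 'rV[R]_K) (a b : R).

Lemma dotDr v w x : dot v (w + x) = dot v w + dot v x.
Proof. by rewrite /dot -big_split; apply: eq_bigr => i _; rewrite mxE mulrDr. Qed.

Lemma dotNr v w : dot v (- w) = - dot v w.
Proof. by rewrite /dot -sumrN; apply: eq_bigr => i _; rewrite mxE mulrN. Qed.

Lemma dotC v w : dot v w = dot w v.
Proof. by apply: eq_bigr => i _; rewrite mulrC. Qed.

Lemma dotZr a v w : dot v (a *: w) = a * dot v w.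
Proof. by rewrite /dot mulr_sumr; apply: eq_bigr => i _; rewrite mxE mulrCA. Qed.

Lemma euclid_ge0 v : 0 <= euclid v.
Proof. exact: sqrtr_ge0. Qed.

Lemma sqr_euclid v : euclid v ^+ 2 = dot v v.
Proof.
rewrite sqr_sqrtr; last by apply: sumr_ge0 => i _; apply: sqr_ge0.
by apply: eq_bigr => i _; rewrite expr2.
Qed.

Lemma sqr_euclidD v w :
  euclid (v + w) ^+ 2 = euclid v ^+ 2 + 2 * dot v w + euclid w ^+ 2.
Proof.
rewrite !sqr_euclid dotDr dotC dotDr [dot (v + w) w]dotC dotDr (dotC w v).
by ring.
Qed.

Lemma euclid0 : euclid (0 : 'rV[R]_K) = 0.
Proof.
by rewrite /euclid big1 ?sqrtr0 // => i _; rewrite mxE expr0n.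
Qed.

Lemma euclid_eq0 v : euclid v = 0 -> v = 0.
Proof.
move=> v0; have : dot v v == 0 by rewrite -sqr_euclid v0 expr0n.
rewrite psumr_eq0 => [/allP v_eq0|i _]; last by rewrite -expr2 sqr_ge0.
apply/rowP => i; have := v_eq0 i (mem_index_enum i).
by rewrite /= mulf_eq0 orbb mxE => /eqP.
Qed.

Lemma euclidZ a v : 0 <= a -> euclid (a *: v) = a * euclid v.
Proof.
move=> a0; rewrite -[in RHS](ger0_norm a0) -sqrtr_sqr /euclid -sqrtrM ?sqr_ge0 //.
by rewrite mulr_sumr; congr Num.sqrt; apply: eq_bigr => i _; rewrite mxE exprMn.
Qed.

Lemma euclidN v : euclid (- v) = euclid v.
Proof. by congr Num.sqrt; apply: eq_bigr => i _; rewrite mxE sqrrN. Qed.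

(** Cauchy-Schwarz, by expanding the squared norm of [euclid w *: v - euclid v *: w]. The expansion
    is twice the product of the two norms times the desired difference; that product is cancelled,
    so vectors of norm zero are treated first. *)
Lemma dot_le_euclid v w : dot v w <= euclid v * euclid w.
Proof.
have := euclid_ge0 v; rewrite le0r => /predU1P[v0|v0].
  by rewrite v0 mul0r (euclid_eq0 v0) /dot big1 // => i _; rewrite mxE mul0r.
have := euclid_ge0 w; rewrite le0r => /predU1P[w0|w0].
  by rewrite w0 mulr0 (euclid_eq0 w0) /dot big1 // => i _; rewrite mxE mulr0.
have := sqr_ge0 (euclid (euclid w *: v + - (euclid v *: w))).
rewrite sqr_euclidD euclidN !euclidZ ?euclid_ge0 // dotNr dotZr dotC dotZr.
rewrite [dot w v]dotC -(ler_pM2l (mulr_gt0 v0 w0) (dot v w)).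
by move: (euclid v) (euclid w) (dot v w) => a b d; lra.
Qed.

Lemma euclid_triangle v w : euclid (v + w) <= euclid v + euclid w.
Proof.
rewrite -ler_sqr ?nnegrE ?addr_ge0 ?euclid_ge0 // sqr_euclidD.
by have := dot_le_euclid v w; lra.
Qed.

Lemma euclid_le_entrywise v w :
  (forall i, `|v 0 i| <= `|w 0 i|) -> euclid v <= euclid w.
Proof.
move=> le_vw; rewrite ler_sqrt; last by apply: sumr_ge0 => i _; apply: sqr_ge0.
apply: ler_sum => i _.
by rewrite -(real_normK (num_real (v 0 i))) -(real_normK (num_real (w 0 i)))
  ler_pXn2r ?nnegrE.
Qed.

Lemma euclid_le_sqrt b v :
  0 <= b -> (forall i, `|v 0 i| <= b) -> euclid v <= b * Num.sqrt K%:R.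
Proof.
move=> b0 le_vb; have -> : b * Num.sqrt K%:R = euclid (const_mx b : 'rV[R]_K).
  rewrite /euclid (eq_bigr (fun=> b ^+ 2)) => [|i _]; last by rewrite mxE.
  by rewrite sumr_const card_ord -[b ^+ 2 *+ K]mulr_natr sqrtrM ?sqr_ge0 //
    sqrtr_sqr ger0_norm.
by apply: euclid_le_entrywise => i; rewrite mxE (ger0_norm b0).
Qed.

Lemma euclid_sum_le (I : Type) (s : seq I) (F : I -> 'rV[R]_K) b :
  (forall c, euclid (F c) <= b) ->
  euclid (\sum_(c <- s) F c) <= (size s)%:R * b.
Proof.
move=> le_Fb; elim: s => [|c s IHs]; first by rewrite big_nil euclid0 mul0r.
rewrite big_cons /= -natr1 mulrDl mul1r addrC.
by apply: le_trans (euclid_triangle _ _) _; apply: lerD.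
Qed.

End Euclid.

(** * Values and costs of the subroutines *)

Section Programs.
Context (R : realType) (K : nat) (C : Type).
Context (f : 'rV[R]_K -> R) (ellt : R -> C -> 'rV[R]_K).
Context (M : R -> 'rV[R]_K -> C) (unif : seq C -> C).

Local Notation eval := (result f ellt M unif).
Local Notation answers := (answer f ellt M unif).
Local Notation events := (trace f ellt M unif).

Lemma result_bind A B (p : prog R C A) (k : A -> prog R C B) :
  eval (bind p k) = eval (k (eval p)).
Proof. by elim: p => //= X i p IHp. Qed.

Lemma trace_bind A B (p : prog R C A) (k : A -> prog R C B) :
  events (bind p k) = events p ++ events (k (eval p)).
Proof. by elim: p => //= X i p ->. Qed.

(* Oracle calls are charged too, so that one quantity bounds the running time
   and all the numbers of queries at once. *)
Definition cost (e : event R) : nat := if e is Work n then n else 1.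

Definition queries_at (tau : R) (e : event R) : bool :=
  match e with Assessed t | Optimized t => t == tau | _ => true end.

(** The accuracy of the queries and the total cost are bundled, so that a single traversal of the
    program establishes both. *)
Definition frugal (tau : R) (n : nat) A (p : prog R C A) :=
  all (queries_at tau) (events p) /\ (\sum_(e <- events p) cost e <= n)%N.

Lemma frugal_ret tau n A (a : A) : frugal tau n (Ret a).
Proof. by split; rewrite //= big_nil. Qed.

Lemma frugal_do n tau m A X (i : instr R C X) (k : X -> prog R C A) :
  queries_at tau (event_of i) -> frugal tau n (k (answers i)) ->
  (cost (event_of i) + n <= m)%N -> frugal tau m (Do i k).
Proof.
move=> i_tau [k_tau kn] nm; split=> /=; first by rewrite i_tau.
by rewrite big_cons (leq_trans _ nm) // leq_add2l.
Qed.

Lemma frugal_bind n1 n2 tau m A B (p : prog R C A) (k : A -> prog R C B) :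
  frugal tau n1 p -> frugal tau n2 (k (eval p)) ->
  (n1 + n2 <= m)%N -> frugal tau m (bind p k).
Proof.
move=> [p_tau pn] [k_tau kn] nm; rewrite /frugal trace_bind all_cat p_tau k_tau.
by split=> //; rewrite big_cat (leq_trans (leq_add pn kn)).
Qed.

Lemma frugal_le n tau m A (p : prog R C A) :
  frugal tau n p -> (n <= m)%N -> frugal tau m p.
Proof. by move=> [p_tau pn] nm; split=> //; apply: leq_trans nm. Qed.

Lemma eval_vmap op xs : eval (vmap op xs) = [seq answers (op x) | x <- xs].
Proof. by elim: xs => //= x xs IHxs; rewrite result_bind IHxs. Qed.

Lemma frugal_vmap tau op xs :
  (forall x, event_of (op x) = Work R 1) -> frugal tau (size xs) (vmap op xs).
Proof.
move=> op1; elim: xs => [|x xs IHxs] /=; first exact: frugal_ret.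
apply: (@frugal_do (size xs)); rewrite ?op1 //=.
by apply: (frugal_bind IHxs (frugal_ret _ 0 _)); rewrite addn0.
Qed.

Lemma eval_vmap2 op xs ys :
  eval (vmap2 op xs ys) = [seq answers (op xy.1 xy.2) | xy <- zip xs ys].
Proof.
by elim: xs ys => [|x xs IHxs] [|y ys] //=; rewrite result_bind IHxs.
Qed.

Lemma frugal_vmap2 tau op xs ys :
  (forall x y, event_of (op x y) = Work R 1) ->
  frugal tau (size xs) (vmap2 op xs ys).
Proof.
move=> op1; elim: xs ys => [|x xs IHxs] [|y ys] /=; try exact: frugal_ret.
apply: (@frugal_do (size xs)); rewrite ?op1 //=.
by apply: (frugal_bind (IHxs _) (frugal_ret _ 0 _)); rewrite addn0.
Qed.

Lemma eval_vmax xs ys :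
  eval (vmax C xs ys) = [seq Num.max xy.1 xy.2 | xy <- zip xs ys].
Proof.
elim: xs ys => [|x xs IHxs] [|y ys] //=; rewrite result_bind IHxs /=.
by rewrite maxEle.
Qed.

Lemma frugal_vmax tau xs ys : frugal tau (size xs) (vmax C xs ys).
Proof.
elim: xs ys => [|x xs IHxs] [|y ys] /=; try exact: frugal_ret.
apply: (@frugal_do (size xs)) => //=.
by apply: (frugal_bind (IHxs _) (frugal_ret _ 0 _)); rewrite addn0.
Qed.

Lemma eval_vzero k : eval (vzero R C k) = nseq k 0.
Proof. by elim: k => //= k IHk; rewrite result_bind IHk. Qed.

Lemma frugal_vzero tau k : frugal tau k (vzero R C k).
Proof.
elim: k => [|k IHk] /=; first exact: frugal_ret.
apply: (@frugal_do k) => //=.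
by apply: (frugal_bind IHk (frugal_ret _ 0 _)); rewrite addn0.
Qed.

Lemma eval_vnorm xs : eval (vnorm C xs) = Num.sqrt (\sum_(x <- xs) x ^+ 2).
Proof.
rewrite result_bind /=; congr Num.sqrt.
elim: xs => [|x xs IHxs] /=; first by rewrite big_nil.
by rewrite result_bind big_cons /= IHxs expr2.
Qed.

Lemma frugal_vnorm tau xs : frugal tau (2 * size xs).+2 (vnorm C xs).
Proof.
suff: frugal tau (2 * size xs).+1 (sumsq C xs).
  move=> sumsq_ok; apply: (frugal_bind (n2 := 1) sumsq_ok); last by rewrite addn1.
  by apply: (@frugal_do 0) => //; apply: frugal_ret.
elim: xs => [|x xs IHxs] /=.
  by apply: (@frugal_do 0) => //; apply: frugal_ret.
apply: (frugal_bind (n2 := 2) IHxs); last lia.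
by apply: (@frugal_do 1) => //; apply: (@frugal_do 0) => //; apply: frugal_ret.
Qed.

Lemma eval_axis q j n :
  eval (axis C q j n) = [seq i%:R * q | i <- iota j n].
Proof. by elim: n j => //= n IHn j; rewrite result_bind IHn. Qed.

Lemma frugal_axis tau q j n : frugal tau (2 * n) (axis C q j n).
Proof.
elim: n j => [|n IHn] j /=; first exact: frugal_ret.
apply: (@frugal_do (2 * n).+1) => //=; last lia.
apply: (@frugal_do (2 * n)) => //=.
by apply: (frugal_bind (IHn _) (frugal_ret _ 0 _)); rewrite addn0.
Qed.

Lemma eval_cons_all x g acc :
  eval (cons_all C x g acc) = [seq x :: v | v <- g] ++ acc.
Proof. by elim: g => //= v g IHg; rewrite result_bind IHg. Qed.

Lemma frugal_cons_all tau x g acc : frugal tau (size g) (cons_all C x g acc).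
Proof.
elim: g => [|v g IHg] /=; first exact: frugal_ret.
apply: (@frugal_do (size g)) => //=.
by apply: (frugal_bind IHg (frugal_ret _ 0 _)); rewrite addn0.
Qed.

Lemma eval_product xs g :
  eval (product C xs g) = [seq x :: v | x <- xs, v <- g].
Proof.
by elim: xs => //= x xs IHxs; rewrite result_bind IHxs eval_cons_all.
Qed.

Lemma frugal_product tau xs g :
  frugal tau (size xs * (size g).+1) (product C xs g).
Proof.
elim: xs => [|x xs IHxs] /=; first exact: frugal_ret.
apply: (@frugal_do (size xs * (size g).+1 + size g)) => //=; last lia.
exact: (frugal_bind IHxs (frugal_cons_all _ _ _ _)).
Qed.

Lemma mem_grid xs k v :
  (v \in eval (grid C xs k)) = (size v == k) && all (mem xs) v.
Proof.
elim: k v => [|k IHk] v; first by rewrite inE; case: v.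
rewrite /= result_bind eval_product; apply/allpairsP/idP => /=.
  by case=> -[x w] [/= xs_x]; rewrite IHk => + -> /=; rewrite xs_x eqSS.
case: v => [|x v] //=; rewrite eqSS => /and3P[v_k xs_x xs_v].
by exists (x, v); rewrite /= IHk v_k xs_v.
Qed.

Lemma size_grid xs k : size (eval (grid C xs k)) = (size xs ^ k)%N.
Proof.
by elim: k => //= k IHk; rewrite result_bind eval_product size_allpairs IHk expnS.
Qed.

(** Adding a coordinate to a grid [g] costs [size xs * (size g).+1], which for nonempty [xs] is at
    most twice the size of the new grid. *)
Lemma frugal_grid tau xs k : (0 < size xs)%N ->
  frugal tau (k * (1 + 2 * size xs ^ k)) (grid C xs k).
Proof.
move=> xs_gt0; elim: k => [|k IHk]; first exact: frugal_ret.
apply: (frugal_do _ (frugal_bind IHk (frugal_product _ _ _) (leqnn _))) => //=.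
rewrite size_grid expnS.
have : (0 < size xs ^ k)%N by rewrite expn_gt0 xs_gt0.
by move: (size xs) (size xs ^ k)%N xs_gt0 => a b a0 b0; nia.
Qed.

Lemma eval_tabulate g :
  eval (tabulate C g) = [seq (r, f (row_of_seq K r)) | r <- g].
Proof. by elim: g => //= r g IHg; rewrite result_bind IHg. Qed.

Lemma frugal_tabulate tau g : frugal tau (size g) (tabulate C g).
Proof.
elim: g => [|r g IHg] /=; first exact: frugal_ret.
apply: (@frugal_do (size g)) => //=.
by apply: (frugal_bind IHg (frugal_ret _ 0 _)); rewrite addn0.
Qed.

Lemma sameP xs ys : size xs = size ys -> reflect (xs = ys) (eval (same C xs ys)).
Proof.
elim: xs ys => [|x xs IHxs] [|y ys] //=; first by left.
case=> /IHxs eqP_xs; rewrite -eq_le; case: eqP => [->|neq_xy] /=.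
  by apply: (iffP eqP_xs) => [->|[]].
by right=> -[].
Qed.

Lemma frugal_same tau xs ys : frugal tau (2 * size xs) (same C xs ys).
Proof.
elim: xs ys => [|x xs IHxs] [|y ys] /=; try exact: frugal_ret.
apply: (@frugal_do (2 * size xs).+1) => //=; last lia.
apply: (@frugal_do (2 * size xs)) => //=.
by case: ifP => _ //; apply: frugal_ret.
Qed.

(** The index [i] ranges over all natural numbers. Beyond the ends of the lists both entries are the
    default 0, so equal lists, even empty ones, have a witness too. *)
Lemma raisedP xs ys : size xs = size ys ->
  reflect (exists2 i, xs`_i <= ys`_i & forall j, j != i -> xs`_j = ys`_j)
    (eval (raised C xs ys)).
Proof.
elim: xs ys => [|x xs IHxs] [|y ys] //=; first by left; exists 0%N.
(* A strictly raised head uses up the only change allowed, so the tails must agree; a lowered head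
   excludes any witness; equal heads leave the change to the tails. *)
case=> eq_size; case: ltgtP => [lt_xy|lt_yx|<-] /=.
- apply: (iffP (sameP eq_size)) => [<-|[[|i] /= le_i eq_j]].
  + by exists 0%N => [|[|j]] //=; apply: ltW.
  + apply: (@eq_from_nth _ 0) => // j _; exact: (eq_j j.+1).
  + by move: lt_xy; have /= -> := eq_j 0%N isT; rewrite ltxx.
- right=> -[[|i] /= le_i eq_j]; first by rewrite leNgt lt_yx in le_i.
  by move: lt_yx; have /= -> := eq_j 0%N isT; rewrite ltxx.
- apply: (iffP (IHxs _ eq_size)) => [[i le_i eq_j]|[[|i] /= le_i eq_j]].
  + by exists i.+1 => // -[|j] //= /eq_j.
  + by exists 0%N => [|j _]; [have /= -> := eq_j 1%N isT | apply: (eq_j j.+1)].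
  + by exists i => // j; apply: (eq_j j.+1).
Qed.

Lemma frugal_raised tau xs ys : frugal tau (2 * size xs) (raised C xs ys).
Proof.
elim: xs ys => [|x xs IHxs] [|y ys] /=; try exact: frugal_ret.
apply: (@frugal_do (2 * size xs).+1) => //=; last lia.
apply: (@frugal_do (2 * size xs)) => //=.
by case: ifP => _; [case: ifP => _ //; apply: frugal_same | apply: frugal_ret].
Qed.

Lemma eval_mono_from x t :
  eval (mono_from C x t) =
  all (fun y => eval (raised C x.1 y.1) ==> (x.2 <= y.2)) t.
Proof.
elim: t => //= y t IHt; rewrite result_bind /=.
by case: ifP => //= ->.
Qed.

Lemma frugal_mono_from tau k x t : size x.1 = k ->
  frugal tau (size t * (2 * k + 2)) (mono_from C x t).
Proof.
move=> x_k; elim: t => [|y t IHt] /=; first exact: frugal_ret.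
apply: (@frugal_do (2 * k + (size t * (2 * k + 2)).+1)) => //=; last lia.
apply: (frugal_bind (n1 := 2 * k)) (leqnn _); first by rewrite -x_k; apply: frugal_raised.
apply: (@frugal_do (size t * (2 * k + 2))) => //=.
by case: ifP => _ //; apply: frugal_ret.
Qed.

Lemma eval_mono t' t :
  eval (mono C t' t) =
  all (fun x => all (fun y => eval (raised C x.1 y.1) ==> (x.2 <= y.2)) t) t'.
Proof.
elim: t' => //= x t' IHt; rewrite result_bind eval_mono_from.
by case: ifP => //= ->.
Qed.

Lemma frugal_mono tau k t' t : all (fun x => size x.1 == k) t' ->
  frugal tau (size t' * (1 + size t * (2 * k + 2))) (mono C t' t).
Proof.
elim: t' => [|x t' IHt] /=; first by move=> _; apply: frugal_ret.
case/andP=> /eqP x_k /IHt{}IHt; rewrite mulSn -addnA.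
apply: (frugal_do _ (frugal_bind (frugal_mono_from _ _ x_k) _ (leqnn _))) => //=.
by case: ifP => _ //; apply: frugal_ret.
Qed.

Lemma insert_sorted tie x t :
  sorted (fun a b => a.2 <= b.2) t ->
  perm_eq (eval (insert C tie x t)) (x :: t) /\
  sorted (fun a b => a.2 <= b.2) (eval (insert C tie x t)).
Proof.
have le_trans2 : transitive (fun a b : seq R * R => a.2 <= b.2).
  by move=> y z w; apply: le_trans.
elim: t => [|y t IHt] //= t_sorted.
have [perm_t sorted_t] := IHt (path_sorted t_sorted).
case: ifP => /= [/andP[-> _] //|not_first].
(* The test fails either because [x.2 <= y.2] is false or because the implication is, and then its
   premise [y.2 <= x.2] holds. The relation [tie] thus has no influence on sortedness. *)
have le_yx : y.2 <= x.2.
  by move: not_first; case: (lerP y.2 x.2) => // /ltW ->.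
rewrite result_bind /=; split.
  by rewrite (perm_trans (y := y :: x :: t)) ?perm_cons // (perm_catCA [:: y] [:: x]).
rewrite path_sortedE // sorted_t andbT (perm_all _ perm_t) /= le_yx /=.
by move: t_sorted; rewrite path_sortedE // => /andP[].
Qed.

Lemma frugal_insert tau tie x t :
  frugal tau (3 * size t) (insert C tie x t).
Proof.
elim: t => [|y t IHt] /=; first exact: frugal_ret.
rewrite mulnS; apply: (@frugal_do (2 + 3 * size t)) => //=.
apply: (@frugal_do (1 + 3 * size t)) => //=.
apply: (@frugal_do (3 * size t)) => //=.
case: ifP => _; first exact: frugal_ret.
by apply: (frugal_bind IHt (frugal_ret _ 0 _)); rewrite addn0.
Qed.

Lemma sort_by_value_sorted tie t :
  perm_eq (eval (sort_by_value C tie t)) t /\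
  sorted (fun a b => a.2 <= b.2) (eval (sort_by_value C tie t)).
Proof.
elim: t => //= x t [perm_t sorted_t]; rewrite result_bind.
have [perm_x sorted_x] := insert_sorted tie x sorted_t.
by split=> //; apply: perm_trans perm_x _; rewrite perm_cons.
Qed.

Lemma frugal_sort_by_value tau tie t :
  frugal tau (size t * (1 + 3 * size t)) (sort_by_value C tie t).
Proof.
elim: t => [|x t IHt] /=; first exact: frugal_ret.
apply: (frugal_do _ (frugal_bind IHt (frugal_insert _ _ _ _) (leqnn _))) => //=.
have [/perm_size -> _] := sort_by_value_sorted tie t.
by move: (size t) => n; nia.
Qed.

(** * The rounds at a grid point and the search over the grid, on row vectors *)

Local Notation row_of := (@row_of_seq R K).

Lemma size_seq_of_row (v : 'rV[R]_K) : size (seq_of_row v) = K.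
Proof. by rewrite size_map size_enum_ord. Qed.

Lemma seq_of_rowK : cancel (@seq_of_row R K) row_of.
Proof.
move=> v; apply/rowP => i; rewrite mxE (nth_map i) ?size_enum_ord //.
by rewrite nth_ord_enum.
Qed.

Lemma row_of_seqK s : size s = K -> seq_of_row (row_of s) = s.
Proof.
move=> s_K; apply: (@eq_from_nth _ 0) => [|i]; rewrite size_seq_of_row ?s_K // => iK.
by rewrite (nth_map (Ordinal iK)) ?size_enum_ord // mxE nth_enum_ord.
Qed.

Lemma seq_of_row0 : nseq K 0 = seq_of_row (0 : 'rV[R]_K).
Proof.
apply: (@eq_from_nth _ 0) => [|i]; rewrite size_nseq ?size_seq_of_row // => iK.
by rewrite nth_nseq iK (nth_map (Ordinal iK)) ?size_enum_ord // mxE.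
Qed.

Lemma eval_vmap_row op (g : R -> R) (v w : 'rV[R]_K) :
  (forall x, answers (op x) = g x) -> (forall i, g (v 0 i) = w 0 i) ->
  eval (vmap op (seq_of_row v)) = seq_of_row w.
Proof.
by move=> op_g g_w; rewrite eval_vmap -map_comp; apply: eq_map => i /=; rewrite op_g.
Qed.

Lemma eval_vmap2_row op (g : R -> R -> R) (u v w : 'rV[R]_K) :
  (forall x y, answers (op x y) = g x y) ->
  (forall i, g (u 0 i) (v 0 i) = w 0 i) ->
  eval (vmap2 op (seq_of_row u) (seq_of_row v)) = seq_of_row w.
Proof.
move=> op_g g_w; rewrite eval_vmap2 zip_map -map_comp.
by apply: eq_map => i /=; rewrite op_g.
Qed.

Lemma eval_vmax_row (u v : 'rV[R]_K) :
  eval (vmax C (seq_of_row u) (seq_of_row v)) =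
  seq_of_row (\row_i Num.max (u 0 i) (v 0 i)).
Proof.
by rewrite eval_vmax zip_map -map_comp; apply: eq_map => i /=; rewrite mxE.
Qed.

Lemma eval_vnorm_row (v : 'rV[R]_K) : eval (vnorm C (seq_of_row v)) = euclid v.
Proof. by rewrite eval_vnorm big_map big_enum. Qed.

Definition lhat (N : R) (r : 'rV[R]_K) (t : nat) (S : 'rV[R]_K) : 'rV[R]_K :=
  \row_i Num.max (t%:R^-1 * S 0 i) (N * r 0 i).

(** Every list operation of a round is the image of a vector operation under [seq_of_row], so the
    remaining rounds again start from images of row vectors. *)
Lemma eval_playS tau N (r : 'rV[R]_K) t n c (S l : 'rV[R]_K) :
  let S' := S + ellt tau c in
  let l' := lhat N r t.+1 S' in
  let p := play tau N (seq_of_row r) t.+1 n (M tau (l' - r))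
    (seq_of_row S') (seq_of_row l') in
  eval (play tau N (seq_of_row r) t n.+1 c (seq_of_row S) (seq_of_row l)) =
    ((eval p).1, c :: (eval p).2).
Proof.
rewrite /= !result_bind.
rewrite (@eval_vmap2_row _ +%R _ _ (S + ellt tau c)) //=; last first.
  by move=> i; rewrite mxE.
rewrite !result_bind.
rewrite (@eval_vmap_row _ (fun x => x / t.+1%:R) _ (t.+1%:R^-1 *: (S + ellt tau c)))
  //=; last by move=> i; rewrite !mxE mulrC.
rewrite (@eval_vmap_row _ ( *%R N) _ (N *: r)) //=; last first.
  by move=> i; rewrite !mxE.
rewrite eval_vmax_row.
have -> : \row_i Num.max ((t.+1%:R^-1 *: (S + ellt tau c)) 0 i) ((N *: r) 0 i) =
    lhat N r t.+1 (S + ellt tau c).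
  by apply/rowP => i; rewrite !mxE.
rewrite (@eval_vmap2_row _ (fun x y => x - y) _ _
  (lhat N r t.+1 (S + ellt tau c) - r)) //=; last by move=> i; rewrite !mxE.
by rewrite result_bind seq_of_rowK.
Qed.

(** Induction principle for the loop. [Inv] speaks of the sum of the losses assessed so far and of
    the choice about to be assessed, because the progress of a round depends on how that choice was
    obtained. With no round to play, the initial vector [l] is returned, whence the case distinction
    in the last clause. *)
Lemma play_invariant tau N r (Inv : nat -> C -> 'rV[R]_K -> Prop) n t c S l :
  (forall t c S, let S' := S + ellt tau c in
    Inv t c S -> Inv t.+1 (M tau (lhat N r t.+1 S' - r)) S') ->
  Inv t c S ->
  let out := eval (play tau N (seq_of_row r) t n c (seq_of_row S) (seq_of_row l)) in
  let S' := S + \sum_(c <- out.2) ellt tau c in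
  [/\ size out.2 = n, exists c', Inv (t + n)%N c' S' &
      out.1 = seq_of_row (if n is 0 then l else lhat N r (t + n) S')].
Proof.
move=> step; elim: n t c S l => [|n IHn] t c S l inv_t.
  by rewrite /= big_nil addr0 addn0; split=> //; exists c.
rewrite eval_playS /= big_cons addrA -addSnnS.
have [out_n inv_n ->] := IHn _ _ _ (lhat N r t.+1 (S + ellt tau c)) (step _ _ _ inv_t).
split=> //; first by rewrite out_n.
(* If [n] is 0, the round just split off was the last one and its sum receives no further terms. *)
by case: n {IHn inv_n} out_n => [/size0nil->|//]; rewrite big_nil addr0 addn0.
Qed.

(** A round makes five passes over vectors of length [K] and executes three single instructions, two
    of which are queries. *)
Lemma frugal_play tau N (r : 'rV[R]_K) t n c (S l : 'rV[R]_K) :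
  frugal tau (n * (5 * K + 3))
    (play tau N (seq_of_row r) t n c (seq_of_row S) (seq_of_row l)).
Proof.
elim: n t c S l => [|n IHn] t c S l /=; first exact: frugal_ret.
set m := (n * _)%N in IHn *.
have sizeK (v : 'rV[R]_K) : (size (seq_of_row v) <= K)%N by rewrite size_seq_of_row.
have map2_ok op (u v : 'rV[R]_K) : (forall x y, event_of (op x y) = Work R 1) ->
    frugal tau K (vmap2 op (seq_of_row u) (seq_of_row v)).
  by move=> op1; apply: (frugal_le _ (sizeK u)); apply: frugal_vmap2.
have map_ok op (v : 'rV[R]_K) : (forall x, event_of (op x) = Work R 1) ->
    frugal tau K (vmap op (seq_of_row v)).
  by move=> op1; apply: (frugal_le _ (sizeK v)); apply: frugal_vmap.
apply: (@frugal_do (m + (5 * K + 2))) => //=; last lia.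
apply: (@frugal_bind K (m + (4 * K + 2))); [exact: map2_ok| |lia].
rewrite (@eval_vmap2_row _ +%R _ _ (S + ellt tau c)) //=; last first.
  by move=> i; rewrite mxE.
apply: (@frugal_do (m + (4 * K + 1))) => //=; last lia.
apply: (@frugal_bind K (m + (3 * K + 1))); [exact: map_ok| |lia].
rewrite (@eval_vmap_row _ (fun x => x / t.+1%:R) _ (t.+1%:R^-1 *: (S + ellt tau c)))
  //=; last by move=> i; rewrite !mxE mulrC.
apply: (@frugal_bind K (m + (2 * K + 1))); [exact: map_ok| |lia].
rewrite (@eval_vmap_row _ ( *%R N) _ (N *: r)) //=; last first.
  by move=> i; rewrite !mxE.
apply: (@frugal_bind K (m + (K + 1))); [|rewrite eval_vmax_row|lia].
  by apply: (frugal_le _ (sizeK _)); apply: frugal_vmax.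
apply: (@frugal_bind K (m + 1)); [exact: map2_ok| |lia].
apply: (@frugal_do m) => //=; last lia.
by apply: (frugal_bind (IHn _ _ _ _) (frugal_ret _ 0 _)); rewrite addn0.
Qed.

Definition trial tau N T (r : 'rV[R]_K) : seq R * seq C :=
  eval (play tau N (seq_of_row r) 0 T (M tau 0)
    (seq_of_row (0 : 'rV[R]_K)) (seq_of_row (0 : 'rV[R]_K))).

Definition accepted beta tau N T (r : 'rV[R]_K) : bool :=
  euclid (row_of (trial tau N T r).1 - r) <= 3 * beta.

Lemma trial_row tau N T r :
  let out := trial tau N T r in
  size out.2 = T /\
  out.1 = seq_of_row (if T is 0 then 0 else lhat N r T (\sum_(c <- out.2) ellt tau c)).
Proof.
have [] := @play_invariant tau N r (fun _ _ _ => True) T 0 (M tau 0) 0 0 => //.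
by rewrite add0r add0n => *; split.
Qed.

Lemma eval_visit T beta tau N (r : 'rV[R]_K) y pts :
  eval (visit C K T beta tau N ((seq_of_row r, y) :: pts)) =
  if accepted beta tau N T r then Some (unif (trial tau N T r).2)
  else eval (visit C K T beta tau N pts).
Proof.
rewrite /= result_bind eval_vzero seq_of_row0 /= result_bind seq_of_rowK -/(trial _ _ _ _).
have [_ l_row] := trial_row tau N T r.
set l := (if _ is 0 then _ else _) in l_row.
rewrite result_bind /= {1}l_row (@eval_vmap2_row _ (fun x y => x - y) _ _ (l - r)) //=;
  last by move=> i; rewrite !mxE.
rewrite result_bind eval_vnorm_row /= /accepted l_row seq_of_rowK.
by case: ifP.
Qed.

(** Apart from its [T] rounds, a trial creates a zero vector ([K]), subtracts ([K]), takes a norm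
    ([2 * K + 2]) and executes four single instructions; a final [Mix] costs [T + 1]. *)
Lemma frugal_visit T beta tau N (pts : seq (seq R * R)) :
  all (fun x => size x.1 == K) pts ->
  frugal tau (size pts * (T * (5 * K + 3) + T + 4 * K + 7))
    (visit C K T beta tau N pts).
Proof.
elim: pts => [|[s y] pts IHpts] /=; first by move=> _; apply: frugal_ret.
case/andP=> /eqP/row_of_seqK<- /IHpts{}IHpts; move: (row_of s) => r {s}.
rewrite mulSn; set m := (size pts * _)%N in IHpts *; set w := (T * _)%N.
apply: (@frugal_bind K (w + T + 3 * K + 7 + m)); [exact: frugal_vzero| |lia].
rewrite eval_vzero seq_of_row0.
apply: (@frugal_do (w + T + 3 * K + 6 + m)); [by rewrite /= eqxx| |by rewrite /=; lia].
rewrite /= seq_of_rowK.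
apply: (@frugal_bind w (T + 3 * K + 6 + m)); [exact: frugal_play| |lia].
rewrite -/(trial _ _ _ _); have [size_T ->] := trial_row tau N T r.
set l := (if _ is 0 then _ else _).
apply: (@frugal_bind K (T + 2 * K + 6 + m)); last lia.
  by apply: (frugal_le (frugal_vmap2 _ _ _ _)) => //; rewrite size_seq_of_row.
rewrite (@eval_vmap2_row _ (fun x y => x - y) _ _ (l - r)) //=;
  last by move=> i; rewrite !mxE.
apply: (@frugal_bind (2 * K).+2 (T + 4 + m)); last lia.
  by apply: (frugal_le (frugal_vnorm _ _)); rewrite size_seq_of_row.
apply: (@frugal_do (T + 3 + m)) => //=; last lia.
apply: (@frugal_do (T + 2 + m)) => //=; last lia.
apply: (@frugal_do (T + 1 + m)) => //=; last lia.
case: ifP => _; last by apply: (frugal_le IHpts); lia.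
apply: (@frugal_do 0) => //=; first exact: frugal_ret.
by rewrite size_T; lia.
Qed.

(** The list is sorted and the search stops no later than at [x], so the point at which it stops has
    value at most [x.2]. *)
Lemma visit_first T beta tau N pts x :
  all (fun x => size x.1 == K) pts -> sorted (fun a b => a.2 <= b.2) pts ->
  x \in pts -> accepted beta tau N T (row_of x.1) ->
  exists y, [/\ y \in pts, y.2 <= x.2, accepted beta tau N T (row_of y.1) &
    eval (visit C K T beta tau N pts) = Some (unif (trial tau N T (row_of y.1)).2)].
Proof.
have le_trans2 : transitive (fun a b : seq R * R => a.2 <= b.2).
  by move=> y z w; apply: le_trans.
elim: pts => [//|[s v] pts IHpts] /andP[/= /eqP s_K pts_K].
rewrite path_sortedE // => /andP[/allP le_v sorted_pts] x_pts x_acc.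
have := eval_visit T beta tau N (row_of s) v pts; rewrite row_of_seqK // => ->.
case: (boolP (accepted _ _ _ _ _)) => [s_acc|s_rej].
  exists (s, v); rewrite mem_head; split=> //=.
  by move: x_pts; rewrite inE => /predU1P[->|/le_v].
move: x_pts; rewrite inE => /predU1P[x_sv|x_pts].
  by rewrite x_sv (negbTE s_rej) in x_acc.
have [y [y_pts le_y y_acc ->]] := IHpts pts_K sorted_pts x_pts x_acc.
by exists y; rewrite inE y_pts orbT.
Qed.

End Programs.

(** * Approachability: when a grid point is accepted, and what acceptance guarantees *)

Section Approachability.
Context (R : realType) (K : nat) (C : Type) (ell : C -> 'rV[R]_K).
Context (f : 'rV[R]_K -> R) (ellt : R -> C -> 'rV[R]_K).
Context (M : R -> 'rV[R]_K -> C) (unif : seq C -> C) (tau : R) (b : bool).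
Context (r : 'rV[R]_K).
Hypothesis (cube_ellt : forall c, cube (ellt tau c)) (cube_r : cube r).

Local Notation trial := (trial f ellt M unif tau b%:R).
Local Notation lhat := (lhat b%:R r).

(* This is [t (lhat - r)] with the division cleared, so that round 0 makes
   sense. *)
Definition gap (t : nat) (S : 'rV[R]_K) : 'rV[R]_K :=
  \row_i (Num.max (S 0 i) (b%:R * t%:R * r 0 i) - t%:R * r 0 i).

Lemma gapE t S : (0 < t)%N -> lhat t S - r = t%:R^-1 *: gap t S.
Proof.
move=> t0; have tR : (0 : R) < t%:R by rewrite ltr0n.
apply/rowP => i; rewrite !mxE mulrBr mulKf ?gt_eqF // maxr_pMr ?invr_ge0 ?ler0n //.
by congr (Num.max _ _ - _); field; rewrite gt_eqF.
Qed.

(** If [b] is false, the maximum is taken with 0 and the two sides agree because the sums are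
    nonnegative. If [b] is true, the gap is the positive part of [S - t r], and the positive part of
    [x + u] is at most the absolute value of [x^+ + u]. *)
Lemma gap_step t (S l : 'rV[R]_K) : cube l -> (forall i, 0 <= S 0 i) ->
  euclid (gap t.+1 (S + l)) <= euclid (gap t S + (l - r)).
Proof.
move=> cube_l S0; apply: euclid_le_entrywise => i; rewrite !mxE -natr1.
have /andP[l0 _] := cube_l i; have /andP[r0 _] := cube_r i; move: (S0 i) => Si0.
rewrite mulrDr mulrDl !mulrDl mulr1 mul1r.
have tr0 : 0 <= t%:R * r 0 i by rewrite mulr_ge0.
case: b; rewrite ?mul1r ?mul0r ?addr0; set tr := t%:R * r 0 i in tr0 *; last first.
  by rewrite !max_l ?addr_ge0 // opprD addrACA.
rewrite [leLHS]ger0_norm ?subr_ge0 ?le_max ?lexx ?orbT // lerBlDr ge_max.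
have : S 0 i <= Num.max (S 0 i) tr by rewrite le_max lexx.
move: (Num.max _ tr) => x le_Sx; set y := x - tr + _.
by have := ler_norm y; have := normr_ge0 y; rewrite /y; lra.
Qed.

(** Induction step for the bound [a t + sqrt (k t)], with [s] and [s'] the roots at [t] and [t + 1].
    The hypotheses bound [G ^+ 2] by [(a t + s)^2 + 2 a (a t + s) + k], and the square of the
    claimed bound exceeds this by [a^2 + 2 a (t + 1) (s' - s)], which is nonnegative. *)
Lemma sqr_gap_bound (E G a s s' t k d : R) :
  0 <= E -> 0 <= a -> 0 <= t -> 0 <= s -> 0 <= s' -> 0 <= k ->
  s ^+ 2 = k * t -> s' ^+ 2 = k * (t + 1) ->
  E <= a * t + s -> d <= a * E -> G ^+ 2 <= E ^+ 2 + 2 * d + k ->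
  G <= a * (t + 1) + s'.
Proof.
move=> E0 a0 t0 s0 s0' k0 ss ss' lE ld lG.
have le_ss : s <= s' by rewrite -ler_sqr ?nnegrE // ss ss' ler_wpM2l //; lra.
have le_E2 : E ^+ 2 <= (a * t + s) ^+ 2 by rewrite lerXn2r ?nnegrE // (le_trans E0).
have le_aE : a * E <= a * (a * t + s) by rewrite ler_wpM2l.
have le_as : a * (t + 1) * s <= a * (t + 1) * s' by rewrite ler_wpM2l // mulr_ge0 //; lra.
have H0 : 0 <= a * (t + 1) + s' by rewrite addr_ge0 // mulr_ge0 //; lra.
have [G0|G0] := ltP G 0; first by lra.
rewrite -ler_sqr ?nnegrE //; apply: (le_trans lG).
have -> : (a * (t + 1) + s') ^+ 2 =
    a ^+ 2 * (t + 1) ^+ 2 + 2 * (a * (t + 1) * s') + s' ^+ 2 by ring.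
have : (a * t + s) ^+ 2 = a ^+ 2 * t ^+ 2 + 2 * (a * t * s) + s ^+ 2 by ring.
rewrite ss ss'; have := sqr_ge0 a.
have : a * (a * t + s) = a ^+ 2 * t + a * s by ring.
have : a * (t + 1) * s = a * t * s + a * s by ring.
have : a ^+ 2 * (t + 1) ^+ 2 = a ^+ 2 * t ^+ 2 + 2 * (a ^+ 2 * t) + a ^+ 2 by ring.
lra.
Qed.

Lemma trial_gap T a : (0 < T)%N -> 0 <= a ->
  (forall t S, (0 < t)%N -> let w := lhat t S - r in
    dot w (ellt tau (M tau w) - r) <= a * euclid w) ->
  euclid (row_of_seq K (trial T r).1 - r) * T%:R <=
    a * T%:R + Num.sqrt (K%:R * T%:R).
Proof.
move=> T0 a0 adv.
(* The last clause concerns the choice of the next round and controls the cross term when the square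
   of the next gap is expanded. *)
pose Inv t c (S : 'rV[R]_K) := [/\ forall i, 0 <= S 0 i,
  euclid (gap t S) <= a * t%:R + Num.sqrt (K%:R * t%:R) &
  dot (gap t S) (ellt tau c - r) <= a * euclid (gap t S)].
have cube_diff c : euclid (ellt tau c - r) ^+ 2 <= K%:R.
  rewrite -[leRHS](sqr_sqrtr (ler0n R K)) ler_sqr ?nnegrE ?euclid_ge0 ?sqrtr_ge0 //.
  rewrite -[leRHS]mul1r; apply: euclid_le_sqrt => // i.
  have := cube_ellt c i; have := cube_r i; rewrite !mxE ler_norml; lra.
have step t c S : let S' := S + ellt tau c in
    Inv t c S -> Inv t.+1 (M tau (lhat t.+1 S' - r)) S'.
  move=> S' [S0 gap_le dot_le].
  split=> [i||]; first by rewrite mxE addr_ge0 //; case/andP: (cube_ellt c i).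
    have sqrtK n : Num.sqrt (K%:R * n%:R : R) ^+ 2 = K%:R * n%:R.
      by rewrite sqr_sqrtr // mulr_ge0.
    have := sqrtK t.+1; rewrite -natr1 => sqrtK1.
    apply: (sqr_gap_bound (euclid_ge0 _) a0 _ _ _ _ (sqrtK t) sqrtK1 gap_le dot_le);
      rewrite ?sqrtr_ge0 //.
    apply: (@le_trans _ _ (euclid (gap t S + (ellt tau c - r)) ^+ 2)).
      by rewrite ler_sqr ?nnegrE ?euclid_ge0 // gap_step.
    by rewrite sqr_euclidD lerD2l.
  (* The optimizer receives the gap divided by [t.+1]; both sides of the inequality are homogeneous
     in that vector, so the factor cancels. *)
  have := adv t.+1 S' isT; rewrite gapE //= euclidZ ?invr_ge0 ?ler0n //.
  by rewrite dotC dotZr dotC mulrCA ler_pM2l // invr_gt0 ltr0n.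
(* The gap of round 0 is zero, so the clause on the first choice [M tau 0] holds trivially. *)
have inv0 : Inv 0%N (M tau 0) 0.
  have gap0 : gap 0 0 = 0.
    by apply/rowP => i; rewrite !mxE mulr0 mul0r maxxx subr0.
  split=> [i||]; rewrite ?mxE // gap0 euclid0 !mulr0 ?sqrtr0 ?addr0 //.
  by rewrite dotC -(scale0r 0) dotZr mul0r.
have [_ [c [_ gap_le _]] out] :=
  @play_invariant R K C f ellt M unif tau b%:R r Inv T 0 (M tau 0) 0 0 step inv0.
rewrite /trial out; case: T T0 gap_le {out} => // T _ gap_le.
rewrite seq_of_rowK add0n gapE // euclidZ ?invr_ge0 ?ler0n //.
by rewrite mulrC mulVKf ?pnatr_eq0.
Qed.

(** The slope [a = beta + 2 * tau] collects the distance from [ell c] to [r], the slack of the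
    optimizer and the error of the assessor. The condition on [T] bounds the square root term by
    [beta * T], and [a + beta <= 3 * beta] as [2 * tau <= beta]. *)
Lemma accepted_near T beta c :
  (0 < T)%N -> 0 < tau -> 0 <= beta -> 2 * tau <= beta -> K%:R <= beta ^+ 2 * T%:R ->
  (forall c, euclid (ellt tau c - ell c) <= tau) ->
  (forall w : 'rV[R]_K, (b -> forall i, 0 <= w 0 i) ->
    dot w (ell (M tau w)) <= dot w (ell c) + tau * euclid w) ->
  euclid (ell c - r) <= beta ->
  accepted f ellt M unif beta tau b%:R T r.
Proof.
move=> T0 tau0 beta0 tau_beta le_T assess opt near.
have TR : (0 : R) < T%:R by rewrite ltr0n.
rewrite /accepted -(ler_pM2r TR).
have a0 : 0 <= beta + 2 * tau by lra.
apply: le_trans (trial_gap T0 a0 _) _.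
  move=> t S t0 /=; set w := lhat t S - r; set c' := M tau w.
  have -> : ellt tau c' - r = (ellt tau c' - ell c') + (ell c' - r) by rewrite addrA subrK.
  rewrite dotDr; have := dot_le_euclid w (ellt tau c' - ell c').
  have := ler_wpM2l (euclid_ge0 w) (assess c').
  have := dot_le_euclid w (ell c - r); have := ler_wpM2l (euclid_ge0 w) near.
  rewrite !(dotDr _ _ (- r)).
  have : dot w (ell c') <= dot w (ell c) + tau * euclid w.
    (* If [b] holds, the maximum with [r] makes [w] nonnegative, so a nonnegative optimizer
       suffices. *)
    apply: opt => b1 i; rewrite !mxE b1 mul1r subr_ge0 le_max lexx orbT //.
  lra.
have : Num.sqrt (K%:R * T%:R) <= beta * T%:R.
  rewrite -[leRHS]ger0_norm ?mulr_ge0 // -sqrtr_sqr ler_sqrt ?sqr_ge0 //.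
  by rewrite exprMn expr2 [T%:R ^+ 2]expr2 mulrA ler_wpM2r // -expr2.
have := ler_wpM2r (ltW TR) tau_beta; lra.
Qed.

(** The loss splits into [tau] for replacing true losses by assessed ones, [3 * beta] from
    acceptance, and [beta / 2] for rounding, where [q / 2] per coordinate amounts to at most
    [beta / 2] in norm. The rounding hypothesis is the only trace of the grid here. *)
Lemma accepted_value T beta q :
  (0 < T)%N -> 0 <= beta -> q * Num.sqrt K%:R <= beta -> 0 <= q ->
  uniform_dist ell unif -> (forall c, cube (ell c)) -> lipschitz_on_cube f ->
  (forall c, euclid (ellt tau c - ell c) <= tau) ->
  (b -> forall x : 'rV[R]_K, cube x -> (forall i, x 0 i <= r 0 i) ->
    exists y, [/\ cube y, forall i, `|x 0 i - y 0 i| <= q / 2 & f y <= f r]) ->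
  accepted f ellt M unif beta tau b%:R T r ->
  f (ell (unif (trial T r).2)) <= f r + 7 / 2 * beta + tau.
Proof.
case: T => // T _ beta0 q_beta q0 unifP cube_ell f_lip assess round; rewrite /accepted.
have [size_T ->] := trial_row f ellt M unif tau b%:R T.+1 r; rewrite seq_of_rowK.
set cs := (trial _ r).2 in size_T *; set S := \sum_(c <- cs) _; move=> acc.
have TR : (0 : R) < T.+1%:R by rewrite ltr0n.
pose avg := T.+1%:R^-1 *: S.
have mean_cube (F : C -> 'rV[R]_K) : (forall c, cube (F c)) ->
    cube (T.+1%:R^-1 *: \sum_(c <- cs) F c).
  move=> cube_F i; rewrite mxE mulrC ler_pdivrMr // mul1r summxE.
  rewrite divr_ge0 ?sumr_ge0 // => [|c _]; last by case/andP: (cube_F c i).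
  rewrite -size_T -sum1_size natr_sum ler_sum // => c _.
  by case/andP: (cube_F c i).
have cube_avg : cube avg by apply: mean_cube.
have ell_mean : ell (unif cs) = T.+1%:R^-1 *: \sum_(c <- cs) ell c.
  by have /eqP size_cs := size_T; rewrite (unifP T (Tuple size_cs)) /mean_loss size_T.
have le_avg : f (ell (unif cs)) <= f avg + tau.
  rewrite -lerBlDl; apply: le_trans (ler_norm _) _.
  apply: le_trans (f_lip _ _ (cube_ell _) cube_avg) _.
  rewrite ell_mean -scalerBr euclidZ ?invr_ge0 // -sumrB mulrC ler_pdivrMr //.
  rewrite mulrC -size_T; apply: euclid_sum_le => c.
  by rewrite -opprB euclidN.
suff : f avg <= f r + 3 * beta + beta / 2 by lra.
have [b1|b0] := boolP b.
  pose x : 'rV[R]_K := \row_i Num.min (avg 0 i) (r 0 i).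
  have cube_x : cube x.
    move=> i; have /andP[? ?] := cube_avg i; have /andP[? ?] := cube_r i.
    by rewrite mxE le_min ge_min; apply/andP; split; [apply/andP|apply/orP; left].
  have [|y [cube_y near_y le_yr]] := round b1 x cube_x.
    by move=> i; rewrite mxE ge_min lexx orbT.
  have := le_trans (ler_norm _) (f_lip _ _ cube_avg cube_x).
  have := le_trans (ler_norm _) (f_lip _ _ cube_x cube_y).
  (* Coordinatewise [a - min (a, r) = max (a, r) - r], so this is exactly the vector whose norm was
     tested. *)
  have -> : avg - x = lhat T.+1 S - r.
    apply/rowP => i; rewrite !mxE b1 mul1r.
    by case: (lerP (_ * S 0 i)) => _; ring.
  have : euclid (x - y) <= q / 2 * Num.sqrt K%:R.
    apply: euclid_le_sqrt; first by rewrite divr_ge0.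
    by move=> i; rewrite !mxE; have := near_y i; rewrite !mxE.
  lra.
(* Without the monotone correction the maximum is with 0 and leaves the nonnegative average
   unchanged. *)
have avgE : avg = lhat T.+1 S.
  by apply/rowP => i; rewrite !mxE (negbTE b0) mul0r max_l //;
    case/andP: (cube_avg i); rewrite mxE.
have := le_trans (ler_norm _) (f_lip _ _ cube_avg cube_r).
rewrite avgE in acc *; lra.
Qed.

End Approachability.

(** * Rounding to the grid, and monotonicity on the grid *)

Section Grid.
Context (R : realType) (K : nat) (q : R) (m : nat).
Hypotheses (q_gt0 : 0 < q) (mq_le1 : m%:R * q <= 1) (lt_1mq : 1 < m.+1%:R * q).

Definition grid_point (x : 'rV[R]_K) : Prop :=
  forall i, exists2 j, (j <= m)%N & x 0 i = j%:R * q.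

Lemma grid_point_cube x : grid_point x -> cube x.
Proof.
move=> x_grid i; have [j le_jm ->] := x_grid i.
rewrite mulr_ge0 ?(ltW q_gt0) //= (le_trans _ mq_le1) // ler_wpM2r ?(ltW q_gt0) //.
by rewrite ler_nat.
Qed.

Lemma floor_multiple y : 0 <= y -> exists j : nat, j%:R * q <= y < j.+1%:R * q.
Proof.
move=> y0; exists `|Num.floor (y / q)|%N.
rewrite -ler_pdivlMr // -ltr_pdivrMr // -natr1 natr_absz.
rewrite ger0_norm ?floor_ge0 ?divr_ge0 ?(ltW q_gt0) //.
by have := floor_itv (y / q); rewrite intrD.
Qed.

(** Every coordinate is rounded down. The multiple [j] found satisfies [j q <= x <= 1 < (m + 1) q],
    hence [j <= m]. *)
Lemma grid_near (x : 'rV[R]_K) : cube x ->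
  exists2 r, grid_point r & euclid (x - r) <= q * Num.sqrt K%:R.
Proof.
move=> cube_x.
have /fin_all_exists[j jP] i : exists j : nat, (j <= m)%N && (`|x 0 i - j%:R * q| <= q).
  have /andP[x0 x1] := cube_x i; have [j /andP[le_jx lt_xj]] := floor_multiple x0.
  exists j; apply/andP; split; last first.
    by rewrite ger0_norm ?subr_ge0 //; move: lt_xj; rewrite -natr1; lra.
  by rewrite -ltnS -(ltr_nat R) -(ltr_pM2r q_gt0) (le_lt_trans le_jx) // (le_lt_trans x1).
exists (\row_i ((j i)%:R * q)) => [i|].
  by exists (j i); [case/andP: (jP i) | rewrite mxE].
by apply: euclid_le_sqrt (ltW q_gt0) _ => i; rewrite !mxE; case/andP: (jP i).
Qed.

Lemma grid_near_below (x r : 'rV[R]_K) :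
  cube x -> grid_point r -> (forall i, x 0 i <= r 0 i) ->
  exists y, [/\ grid_point y, forall i, `|x 0 i - y 0 i| <= q / 2
    & forall i, y 0 i <= r 0 i].
Proof.
move=> cube_x r_grid le_xr.
have /fin_all_exists[j jP] i : exists j : nat,
    [&& (j <= m)%N, `|x 0 i - j%:R * q| <= q / 2 & j%:R * q <= r 0 i].
  have /andP[x0 _] := cube_x i; have [j /andP[le_jx lt_xj]] := floor_multiple x0.
  have := le_xr i; have [k le_km ->] := r_grid i => le_xk.
  have [near|far] := lerP (x 0 i - j%:R * q) (q / 2).
    exists j; rewrite (le_trans le_jx le_xk) andbT ger0_norm ?subr_ge0 // near andbT.
    rewrite (leq_trans _ le_km) // -(ler_nat R) -(ler_pM2r q_gt0).
    exact: le_trans le_jx le_xk.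
  (* Rounding up occurs only when [x] lies strictly above [j q]. As [x] is at most [k q], the next
     multiple is still at most [k q]; this is where [r] being a grid point matters. *)
  have lt_jk : (j < k)%N.
    rewrite -(ltr_nat R) -(ltr_pM2r q_gt0); apply: lt_le_trans le_xk; lra.
  exists j.+1; rewrite (leq_trans lt_jk) //= ler_pM2r // ler_nat lt_jk andbT.
  by rewrite ltr0_norm ?subr_lt0 // -natr1; lra.
exists (\row_i ((j i)%:R * q)); split=> i; rewrite ?mxE; case/and3P: (jP i) => //.
by move=> le_jm _ _; exists (j i).
Qed.

Definition grid_monotone (f : 'rV[R]_K -> R) : Prop :=
  forall x y, grid_point x -> grid_point y -> (forall i, x 0 i <= y 0 i) -> f x <= f y.

Context (C : Type) (f : 'rV[R]_K -> R) (ellt : R -> C -> 'rV[R]_K).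
Context (M : R -> 'rV[R]_K -> C) (unif : seq C -> C).

Local Notation eval := (result f ellt M unif).
Local Notation points := (eval (grid C (eval (axis C q 0 m.+1)) K)).

Lemma mem_points s :
  reflect (exists2 r, grid_point r & s = seq_of_row r) (s \in points).
Proof.
rewrite mem_grid eval_axis.
have axisP x : reflect (exists2 j, (j <= m)%N & x = j%:R * q)
    (x \in [seq i%:R * q | i <- iota 0 m.+1]).
  by apply: (iffP mapP) => -[j]; rewrite ?mem_iota => le_jm ->; exists j; rewrite ?mem_iota.
apply: (iffP andP) => [[/eqP s_K /allP s_axis]|[r r_grid ->]].
  exists (row_of_seq K s); last by rewrite row_of_seqK.
  by move=> i; rewrite mxE; apply/axisP/s_axis/mem_nth; rewrite s_K.
rewrite size_seq_of_row; split=> //; apply/allP => x /mapP[i _ ->].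
exact/axisP.
Qed.

Local Notation table := [seq (r, f (row_of_seq K r)) | r <- points].

Lemma nth_seq_of_row (x : 'rV[R]_K) (i : 'I_K) : (seq_of_row x)`_i = x 0 i.
Proof. by rewrite -{2}(seq_of_rowK x) mxE. Qed.

Lemma mono_table_raised x y : grid_point x -> grid_point y ->
  eval (mono C table table) ->
  (exists2 i, x 0 i <= y 0 i & forall j, j != i -> x 0 j = y 0 j) -> f x <= f y.
Proof.
move=> x_grid y_grid; rewrite eval_mono => /allP mono_t [i le_i eq_j].
have in_t z : grid_point z -> (seq_of_row z, f z) \in table.
  move=> z_grid; apply/mapP; exists (seq_of_row z); last by rewrite seq_of_rowK.
  by apply/mem_points; exists z.
move: (mono_t _ (in_t _ x_grid)) => /allP/(_ _ (in_t _ y_grid))/implyP; apply.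
apply/raisedP; first by rewrite !size_seq_of_row.
exists i => [|j neq_ji]; first by rewrite !nth_seq_of_row.
(* Past index [K] both lists yield the default 0. *)
have [lt_jK|le_Kj] := ltnP j K; last by rewrite !nth_default ?size_seq_of_row.
by rewrite (nth_seq_of_row x (Ordinal lt_jK)) (nth_seq_of_row y (Ordinal lt_jK)) eq_j.
Qed.

(** The test compares only points differing in one coordinate. The points [z k], with the first [k]
    coordinates of [y] and the others of [x], form a chain of such comparisons from [x] to [y]
    inside the grid. *)
Lemma mono_table_monotone : eval (mono C table table) -> grid_monotone f.
Proof.
move=> mono_t x y x_grid y_grid le_xy.
pose z k : 'rV[R]_K := \row_i (if (i < k)%N then y 0 i else x 0 i).
have z_grid k : grid_point (z k) by move=> i; rewrite mxE; case: ifP.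
suff le_z k : (k <= K)%N -> f x <= f (z k).
  have -> : y = z K by apply/rowP => i; rewrite mxE ltn_ord.
  exact: le_z.
elim: k => [_|k IHk lt_kK]; first by have -> : z 0%N = x by apply/rowP => i; rewrite mxE.
apply: le_trans (IHk (ltnW lt_kK)) _; apply: mono_table_raised => //.
exists (Ordinal lt_kK) => [|j neq_jk]; rewrite !mxE /= ?ltnn ?ltnS ?leqnn //.
by rewrite [(j <= k)%N]leq_eqVlt -[_ == k :> nat]/(j == Ordinal lt_kK) (negbTE neq_jk).
Qed.

(** For a nondecreasing [f] the algorithm sets [N = 1], which keeps the vectors passed to a
    nonnegative optimizer in its domain. *)
Lemma nondecreasing_mono_table :
  nondecreasing_on_cube f -> eval (mono C table table).
Proof.
move=> f_mono; rewrite eval_mono; apply/allP => u /mapP[s /mem_points[x x_grid ->] ->].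
apply/allP => v /mapP[t /mem_points[y y_grid ->] ->] /=; rewrite !seq_of_rowK.
have eq_size : size (seq_of_row x) = size (seq_of_row y) by rewrite !size_seq_of_row.
apply/implyP => /(raisedP _ _ _ _ eq_size)[i le_i eq_j].
have eq_row (j : 'I_K) : j != i :> nat -> x 0 j = y 0 j.
  by move=> /eq_j; rewrite !nth_seq_of_row.
(* A witness index outside the vector leaves no coordinate changed. *)
have [lt_iK|le_Ki] := ltnP i K; last first.
  suff -> : x = y by [].
  by apply/rowP => j; apply: eq_row; rewrite neq_ltn (leq_trans (ltn_ord j)).
have [cube_x cube_y] := (grid_point_cube x_grid, grid_point_cube y_grid).
have le_xy : x 0 (Ordinal lt_iK) <= y 0 (Ordinal lt_iK) by rewrite -!nth_seq_of_row.
by apply: f_mono cube_x cube_y _ le_xy => j; apply: eq_row.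
Qed.

End Grid.

(** * Reading query accuracies and counts off a trace *)

Lemma queries_at_taus (R : realType) (t : R) tr : all (queries_at t) tr ->
  all (pred1 t) (assessor_taus tr) /\ all (pred1 t) (optimizer_taus tr).
Proof.
by elim: tr => // -[n||s|s] tr IHtr //= /andP[/= s_t /IHtr[? ?]]; rewrite ?s_t.
Qed.

Lemma counts_le_cost (R : realType) (tr : seq (event R)) :
  [/\ (size (assessor_taus tr) <= \sum_(e <- tr) cost e)%N,
      (size (optimizer_taus tr) <= \sum_(e <- tr) cost e)%N,
      (runtime tr <= \sum_(e <- tr) cost e)%N &
      (calls_f tr <= \sum_(e <- tr) cost e)%N].
Proof.
rewrite /runtime; elim: tr => [|e tr [a_le o_le r_le c_le]]; first by rewrite !big_nil.
by rewrite !big_cons; case: e => [n||s|s] /=; split; lia.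
Qed.

(** * The algorithm with its actual parameters *)

Section GroupOptimizer.
Context (R : realType) (K : nat) (C : Type) (eps : R).
Context (f : 'rV[R]_K -> R) (ellt : R -> C -> 'rV[R]_K).
Context (M : R -> 'rV[R]_K -> C) (unif : seq C -> C).
Context (tie : seq R -> seq R -> bool).
Hypotheses (K_gt0 : (0 < K)%N) (eps_gt0 : 0 < eps) (eps_le1 : eps <= 1).

Local Notation eval := (result f ellt M unif).

Let beta : R := eps / 5.
Let q : R := beta / Num.sqrt K%:R.
Let tau : R := beta * beta / Num.sqrt K%:R.
Let kb : R := K%:R / (beta * beta).
Let T : nat := `|Num.ceil (kb * ln kb)|%N.
Let m : nat := `|Num.floor (1 / q)|%N.
Let points := eval (grid C (eval (axis C q 0 m.+1)) K).
Let table := [seq (r, f (row_of_seq K r)) | r <- points].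
Let pts := eval (sort_by_value C tie table).

(** The program after the axis has been built. The fourteen scalar instructions before it evaluate
    by conversion to the parameters above. *)
Let rest (xs : seq R) : prog R C (option C) :=
  bind (grid C xs K) (fun g =>
  bind (tabulate C g) (fun t =>
  bind (mono C t t) (fun b : bool =>
  Do (Nat b) (fun N =>
  bind (sort_by_value C tie t) (fun pts => visit C K T beta tau N pts))))).

Lemma eval_GroupOpt : eval (GroupOpt C K tie eps) =
  eval (visit C K T beta tau (eval (mono C table table) : nat)%:R pts).
Proof.
have -> : eval (GroupOpt C K tie eps) = eval (bind (axis C q 0 m.+1) rest) by [].
rewrite result_bind /rest !result_bind eval_tabulate.
rewrite -[eval (Do _ _)]/(eval (bind (sort_by_value C tie table) _)).
by rewrite result_bind.
Qed.

Lemma size_points : size points = (m.+1 ^ K)%N.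
Proof. by rewrite size_grid eval_axis size_map size_iota. Qed.

Lemma size_table : size table = (m.+1 ^ K)%N.
Proof. by rewrite size_map size_points. Qed.

Lemma pts_table : perm_eq pts table.
Proof. by case: (sort_by_value_sorted f ellt M unif tie table). Qed.

Lemma table_sizes : all (fun x => size x.1 == K) table.
Proof. by apply/allP => x /mapP[s + ->]; rewrite mem_grid => /andP[]. Qed.

Lemma frugal_GroupOpt :
  frugal f ellt M unif tau (32 * K.+1 * (m.+1 ^ K) ^ 2 * T.+1) (GroupOpt C K tie eps).
Proof.
have sz_table := size_table; have sz_points := size_points.
set n := (m.+1 ^ K)%N in sz_table sz_points *.
have m_n : (m < n)%N by rewrite -{1}(expn1 m.+1) leq_pexp2l.
(* The budgets are built from the end of the program: [c7] covers sorting and visiting, [c6] adds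
   the monotonicity test, [c5] the grid and its table, [c4] the axis. *)
pose visits := (n * (T * (5 * K + 3) + T + 4 * K + 7))%N.
pose c7 := (n * (1 + 3 * n) + visits)%N.
pose c6 := (n * (1 + n * (2 * K + 2)) + (1 + c7))%N.
pose c5 := (K * (1 + 2 * n) + (n + c6))%N.
pose c4 := (2 * m.+1 + c5)%N.
(* The prologue has ten scalar instructions, a [Ceil] costing [T.+1], two more instructions, and a
   [Floor] costing [m.+1]. *)
apply: (@frugal_le _ _ _ _ _ _ _ (10 + (T.+1 + (2 + (m.+1 + c4))))); last first.
  have n_nn : (n <= n ^ 2)%N by rewrite -{1}(expn1 n) leq_pexp2l // (leq_ltn_trans _ m_n).
  have nn0 : (0 < n ^ 2)%N by apply: leq_trans n_nn; lia.
  rewrite /c4 /c5 /c6 /c7 /visits.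
  have -> : (n * (1 + 3 * n) = n + 3 * n ^ 2)%N by ring.
  have -> : (n * (1 + n * (2 * K + 2)) = n + n ^ 2 * (2 * K + 2))%N by ring.
  move: (n ^ 2)%N n_nn nn0 => nn n_nn nn0; nia.
have rest_ok : frugal f ellt M unif tau c4 (bind (axis C q 0 m.+1) rest).
  apply: (frugal_bind (frugal_axis _ _ _ _ _ _ _ _) _ (leqnn _)); rewrite /rest.
  have axis_gt0 : (0 < size (eval (axis C q 0 m.+1)))%N by rewrite eval_axis.
  have := frugal_grid f ellt M unif tau K axis_gt0.
  rewrite {1}eval_axis size_map size_iota -/n => grid_ok.
  apply: (frugal_bind grid_ok _ (leqnn _)) => //.
  have := frugal_tabulate f ellt M unif tau points; rewrite sz_points => tab_ok.
  apply: (frugal_bind tab_ok _ (leqnn _)); rewrite eval_tabulate -/table.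
  have := frugal_mono f ellt M unif tau table table_sizes; rewrite sz_table => mono_ok.
  apply: (frugal_bind mono_ok _ (leqnn _)).
  apply: (frugal_do (n := c7)) => //.
  have := frugal_sort_by_value f ellt M unif tau tie table; rewrite sz_table => sort_ok.
  apply: (frugal_bind sort_ok _ (leqnn _)); rewrite -/pts /visits.
  rewrite -{1}sz_table -(perm_size pts_table); apply: frugal_visit.
  by rewrite (perm_all _ pts_table); apply: table_sizes.
rewrite /GroupOpt.
by do 14!(apply: frugal_do; [by []| |exact: leqnn]).
Qed.

Let K_ge1 : (1 : R) <= K%:R.
Proof. by rewrite ler1n. Qed.

Let sqrtK_ge1 : 1 <= Num.sqrt K%:R :> R.
Proof. by rewrite -[leLHS]sqrtr1 ler_wsqrtr. Qed.

Let sqrtK_gt0 : 0 < Num.sqrt K%:R :> R.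
Proof. exact: lt_le_trans ltr01 sqrtK_ge1. Qed.

Let beta_gt0 : 0 < beta.
Proof. by rewrite divr_gt0. Qed.

Let beta_le : beta <= 1 / 5.
Proof. by rewrite ler_pM2r // invr_gt0. Qed.

Let q_gt0 : 0 < q.
Proof. exact: divr_gt0. Qed.

Let q_sqrtK : q * Num.sqrt K%:R = beta.
Proof. by rewrite divfK // gt_eqF. Qed.

Let tau_gt0 : 0 < tau.
Proof. exact: divr_gt0 (mulr_gt0 beta_gt0 beta_gt0) sqrtK_gt0. Qed.

(** Uses [beta <= 1 / 5], which comes from [eps <= 1]. It yields both [2 * tau <= beta] and room in
    the final error budget. *)
Let tau_le : tau <= beta / 5.
Proof.
rewrite ler_pdivrMr //; move: beta_gt0 beta_le sqrtK_ge1.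
by move: beta (Num.sqrt _) => x s; nra.
Qed.

Let tauE : tau = eps ^+ 2 / (25 * Num.sqrt K%:R).
Proof.
have K0 : Num.sqrt K%:R != 0 :> R by rewrite gt_eqF.
by rewrite /tau /beta; field; rewrite K0.
Qed.

Let floor_q : m%:R * q <= 1 /\ 1 < m.+1%:R * q.
Proof.
have q1 : 0 <= 1 / q by rewrite divr_ge0 // ltW.
rewrite -ler_pdivlMr // -ltr_pdivrMr // -natr1 natr_absz ger0_norm ?floor_ge0 //.
by have := floor_itv (1 / q); rewrite intrD => /andP.
Qed.

(** Makes the logarithm in the number of rounds at least 1. *)
Let kb_ge25 : 25 <= kb.
Proof.
rewrite ler_pdivlMr; last exact: mulr_gt0.
apply: (le_trans _ K_ge1).
by move: beta_gt0 beta_le; move: beta => x; nra.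
Qed.

(* [ln 25 >= ln 4 = - 2 ln (1 / 2) >= 1], as [1 / 2 <= exp (- 1 / 2)]. *)
Let ln_kb_ge1 : 1 <= ln kb.
Proof.
have half : (2^-1 : R) <= expR (- 2^-1) by have := expR_ge1Dx (- 2^-1 : R); lra.
have e1 : expR (- 2^-1) * expR (- 2^-1) * expR 1 = 1 :> R.
  rewrite -!expRD; have -> : (- 2^-1 + - 2^-1 + 1 : R) = 0 by lra.
  exact: expR0.
have le4 : (expR 1 : R) <= 4.
  have quarter : (4^-1 : R) <= expR (- 2^-1) * expR (- 2^-1).
    have -> : (4^-1 : R) = 2^-1 * 2^-1 by lra.
    by apply: ler_pM => //; lra.
  have := ler_wpM2r (expR_ge0 (1 : R)) quarter; rewrite e1; lra.
rewrite -ler_expR lnK ?posrE; first by move: le4 kb_ge25; lra.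
by apply: (lt_le_trans _ kb_ge25).
Qed.

(** The upper bound, from [ln x <= x] and the rounding, keeps the number of rounds polynomial in
    [1 / eps]. *)
Let T_bounds : kb * ln kb <= T%:R /\ T%:R <= kb ^+ 2 + 1.
Proof.
have kb0 : 0 < kb by apply: (lt_le_trans _ kb_ge25).
have pos : 0 <= kb * ln kb by exact: mulr_ge0 (ltW kb0) (le_trans ler01 ln_kb_ge1).
rewrite natr_absz ger0_norm; last by rewrite ceil_ge0 (lt_le_trans (ltrN10 _) pos).
have /andP[lt_T le_T] := ceil_itv (kb * ln kb); split=> //.
have le_ln : ln kb <= kb.
  have := @le_ln1Dx R (kb - 1); rewrite addrCA subrr addr0; move: kb0; lra.
have := ler_wpM2l (ltW kb0) le_ln; rewrite -expr2.
by move: lt_T; rewrite intrD; lra.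
Qed.

(** As [ln kb] is at least 1, [T] is at least [kb], that is [K / beta^2]. *)
Let K_le_T : K%:R <= beta ^+ 2 * T%:R.
Proof.
rewrite -ler_pdivrMl ?exprn_gt0 // mulrC expr2; apply: (le_trans _ (proj1 T_bounds)).
by rewrite -/kb -[leLHS]mulr1 ler_wpM2l // (le_trans _ kb_ge25).
Qed.

Let T_gt0 : (0 < T)%N.
Proof.
rewrite lt0n; apply: contraTneq K_le_T => ->.
by rewrite mulr0 -ltNge (lt_le_trans ltr01).
Qed.

Context (Cbar : set C) (ell : C -> 'rV[R]_K).
Hypotheses (unifP : uniform_dist ell unif) (cube_ell : forall c, cube (ell c)).
Hypothesis assess : loss_assessor ell ellt.
Hypothesis cases : (lipschitz_on_cube f /\ linear_optimizer ell Cbar M) \/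
  [/\ nondecreasing_on_cube f, lipschitz_on_cube f & nonneg_linear_optimizer ell Cbar M].

Lemma GroupOpt_correct : Cbar !=set0 ->
  exists2 c, eval (GroupOpt C K tie eps) = Some c
    & forall cbar, Cbar cbar -> f (ell c) <= f (ell cbar) + eps.
Proof.
have [mq lt_mq] := floor_q; rewrite eval_GroupOpt; set b := eval (mono C table table).
set out := eval _.
have cube_ellt c : cube (ellt tau c) by case: (assess c tau_gt0).
have assess_tau c : euclid (ellt tau c - ell c) <= tau by case: (assess c tau_gt0).
have tau2_le : 2 * tau <= beta.
  by move: tau_le beta_gt0; move: tau beta => x y; lra.
have f_lip : lipschitz_on_cube f by case: cases => -[].
(* Both cases of the theorem reduce to this form: a linear optimizer handles every [w], and for
   nondecreasing [f] the test makes [b] true, so [w] is nonnegative. *)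
have opt (w : 'rV[R]_K) : (b -> forall i, 0 <= w 0 i) -> forall cbar, Cbar cbar ->
    dot w (ell (M tau w)) <= dot w (ell cbar) + tau * euclid w.
  case: cases => [[_ opt] _|[f_mono _ opt] w_ge0]; first exact: opt.
  apply: opt => //; apply: w_ge0.
  exact: nondecreasing_mono_table f_mono.
have near_accepted cbar : Cbar cbar -> exists r, [/\ (seq_of_row r, f r) \in pts,
    accepted f ellt M unif beta tau b%:R T r & f r <= f (ell cbar) + beta].
  move=> cbarP; have [r r_grid near] := grid_near q_gt0 lt_mq (cube_ell cbar).
  have cube_r := grid_point_cube q_gt0 mq r_grid.
  rewrite q_sqrtK in near; exists r; split.
  - rewrite (perm_mem pts_table); apply/mapP; exists (seq_of_row r).
      by apply/mem_points; exists r.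
    by rewrite seq_of_rowK.
  - exact: (accepted_near f unif cube_ellt cube_r T_gt0 tau_gt0 (ltW beta_gt0) tau2_le
      K_le_T assess_tau (fun w w_ge0 => opt w w_ge0 _ cbarP) near).
  - have := le_trans (ler_norm _) (f_lip _ _ cube_r (cube_ell cbar)).
    by rewrite -euclidN opprB; lra.
have pts_sizes : all (fun x => size x.1 == K) pts.
  by rewrite (perm_all _ pts_table) table_sizes.
have [_ pts_sorted] := sort_by_value_sorted f ellt M unif tie table.
have select cbar : Cbar cbar -> exists r, [/\ grid_point q m r,
    accepted f ellt M unif beta tau b%:R T r, f r <= f (ell cbar) + beta &
    out = Some (unif (trial f ellt M unif tau b%:R T r).2)].
  move=> /near_accepted[r [r_pts r_acc le_r]].
  have r_acc' : accepted f ellt M unif beta tau b%:R T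
      (row_of_seq K (seq_of_row r, f r).1) by rewrite seq_of_rowK.
  have [y [y_pts le_y y_acc eval_y]] := visit_first pts_sizes pts_sorted r_pts r_acc'.
  move: y_pts; rewrite (perm_mem pts_table) => /mapP[s /mem_points[y' y'_grid ->] y_eq].
  move: le_y y_acc eval_y; rewrite y_eq /= seq_of_rowK => le_y y_acc eval_y.
  by exists y'; split=> //; apply: le_trans le_y le_r.
(* The point [cbar0] only shows that something is returned. Each [cbar] gets its own grid point
   [r'], but its trial produces the same [out], so the bound transfers to the returned choice. *)
case=> cbar0 /select[r [r_grid r_acc _ out_r]].
exists (unif (trial f ellt M unif tau b%:R T r).2) => // cbar.
move=> /select[r' [r'_grid r'_acc le_r']].
rewrite out_r => -[->].
have round : b -> forall x : 'rV[R]_K, cube x -> (forall i, x 0 i <= r' 0 i) ->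
    exists y, [/\ cube y, forall i, `|x 0 i - y 0 i| <= q / 2 & f y <= f r'].
  move=> bP x cube_x le_xr.
  have [y [y_grid near_y le_yr]] := grid_near_below q_gt0 cube_x r'_grid le_xr.
  exists y; split=> //; first exact: grid_point_cube y_grid.
  exact: mono_table_monotone bP _ _ y_grid r'_grid le_yr.
have q_le : q * Num.sqrt K%:R <= beta by rewrite q_sqrtK.
have := accepted_value cube_ellt (grid_point_cube q_gt0 mq r'_grid) T_gt0 (ltW beta_gt0)
  q_le (ltW q_gt0) unifP cube_ell f_lip assess_tau round r'_acc.
(* The total error is [beta + 7 / 2 * beta + tau], at most [4.7 * beta], hence below
   [eps = 5 * beta]. *)
have epsE : eps = 5 * beta by rewrite /beta; field.
move: le_r' tau_le beta_gt0 epsE; move: (f (ell (unif _))) => y.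
by move: tau beta => t x; lra.
Qed.

Lemma GroupOpt_queries : let tr := trace f ellt M unif (GroupOpt C K tie eps) in
  (forall t, t \in assessor_taus tr -> t = eps ^+ 2 / (25 * Num.sqrt K%:R)) /\
  (forall t, t \in optimizer_taus tr -> t = eps ^+ 2 / (25 * Num.sqrt K%:R)).
Proof.
rewrite -tauE; have [/queries_at_taus[/allP a_tau /allP o_tau] _] := frugal_GroupOpt.
by split=> t; [move/a_tau/eqP | move/o_tau/eqP].
Qed.

(** With [X = 1 / eps], the factors come from [m + 1 <= (5 K + 1) X], since [1 / q = 5 sqrt K X],
    and from [T + 1 <= (625 K^2 + 2) X^4], since [kb = 25 K X^2]. The squared grid size accounts for
    degree [2 * K] and the rounds for degree 4. *)
Definition cost_polynomial : {poly R} :=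
  (32 * K.+1 * ((5 * K + 1) ^ K) ^ 2 * (625 * K ^ 2 + 2))%:R *: 'X^(2 * K + 4).

Lemma GroupOpt_cost_le :
  (32 * K.+1 * (m.+1 ^ K) ^ 2 * T.+1)%:R <= cost_polynomial.[eps^-1].
Proof.
rewrite hornerZ hornerXn; set X := eps^-1.
have X_ge1 : 1 <= X by rewrite invf_ge1.
have X0 : 0 <= X by apply: le_trans X_ge1.
have sqrtK_le : Num.sqrt K%:R <= K%:R :> R.
  rewrite -[leRHS]ger0_norm // -sqrtr_sqr ler_sqrt ?sqr_ge0 //.
  by rewrite expr2 -[leLHS]mulr1 ler_wpM2l.
have m_le : m.+1%:R <= (5 * K + 1)%:R * X.
  have [mq _] := floor_q; move: mq; rewrite -ler_pdivlMr // => m_le.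
  have qE : 1 / q = 5 * (Num.sqrt K%:R * X).
    by rewrite /q /beta /X; field; rewrite !gt_eqF.
  have := ler_wpM2r X0 sqrtK_le; move: m_le; rewrite qE -natr1 natrD natrM; lra.
have T_le : T.+1%:R <= (625 * K ^ 2 + 2)%:R * X ^+ 4.
  have [_] := T_bounds; have -> : kb = 25 * K%:R * X ^+ 2.
    by rewrite /kb /beta /X; field; rewrite gt_eqF.
  have : 1 <= X ^+ 4 by rewrite exprn_ege1.
  have -> : (25 * K%:R * X ^+ 2) ^+ 2 = 625 * (K%:R ^+ 2 * X ^+ 4) by ring.
  by rewrite -natr1 natrD natrM natrX; lra.
have mK_le : (m.+1 ^ K)%:R <= ((5 * K + 1) ^ K)%:R * X ^+ K.
  by rewrite !natrX -exprMn lerXn2r ?nnegrE // mulr_ge0.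
have sqr_le : ((m.+1 ^ K) ^ 2)%:R <= (((5 * K + 1) ^ K) ^ 2)%:R * X ^+ (2 * K).
  rewrite !(natrX _ (_ ^ K)%N 2) [(2 * K)%N]mulnC exprM -exprMn lerXn2r ?nnegrE ?mulr_ge0 //.
  exact: exprn_ge0.
move: ((m.+1 ^ K) ^ 2)%N (((5 * K + 1) ^ K) ^ 2)%N sqr_le => a b ab_le.
rewrite exprD -!mulnA !natrM -!mulrA !ler_wpM2l //.
rewrite [leRHS]mulrA mulrACA.
by apply: ler_pM.
Qed.

Lemma GroupOpt_costs : let tr := trace f ellt M unif (GroupOpt C K tie eps) in
  [/\ (size (assessor_taus tr))%:R <= cost_polynomial.[eps^-1],
      (size (optimizer_taus tr))%:R <= cost_polynomial.[eps^-1],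
      (runtime tr)%:R <= cost_polynomial.[eps^-1] &
      (calls_f tr)%:R <= cost_polynomial.[eps^-1]].
Proof.
move=> tr; have [_ tr_cost] := frugal_GroupOpt; rewrite -/tr in tr_cost.
have le_poly n : (n <= \sum_(e <- tr) cost e)%N -> n%:R <= cost_polynomial.[eps^-1].
  move=> n_le; apply: le_trans GroupOpt_cost_le.
  by rewrite ler_nat; apply: leq_trans tr_cost.
by have [? ? ? ?] := counts_le_cost tr; split; apply: le_poly.
Qed.

End GroupOptimizer.

Theorem theorem3 (R : realType) (K : nat) (K_gt0 : (0 < K)%N) :
  exists P : {poly R},
  forall (C : Type) (Cbar : set C) (ell : C -> 'rV[R]_K)
    (unif : seq C -> C) (ellt : R -> C -> 'rV[R]_K)
    (M : R -> 'rV[R]_K -> C) (f : 'rV[R]_K -> R)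
    (tie : seq R -> seq R -> bool) (eps : R),
  closed_under_randomization ell [set: C] ->
  closed_under_randomization ell Cbar ->
  uniform_dist ell unif ->
  (forall c, cube (ell c)) ->
  loss_assessor ell ellt ->
  (lipschitz_on_cube f /\ linear_optimizer ell Cbar M) \/
  [/\ nondecreasing_on_cube f, lipschitz_on_cube f
    & nonneg_linear_optimizer ell Cbar M] ->
  0 < eps <= 1 ->
  let out := result f ellt M unif (GroupOpt C K tie eps) in
  let tr := trace f ellt M unif (GroupOpt C K tie eps) in
  [/\ (* correctness *)
      Cbar !=set0 ->
        exists2 c, out = Some c
          & forall cbar, Cbar cbar -> f (ell c) <= f (ell cbar) + eps,
      (* all queries are made with the stated accuracy *)
      (forall tau, tau \in assessor_taus tr ->
         tau = eps ^+ 2 / (25 * Num.sqrt K%:R)) /\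
      (forall tau, tau \in optimizer_taus tr ->
         tau = eps ^+ 2 / (25 * Num.sqrt K%:R)),
      (* numbers of queries *)
      (size (assessor_taus tr))%:R <= P.[eps^-1] /\
      (size (optimizer_taus tr))%:R <= P.[eps^-1],
      (* additional runtime *)
      (runtime tr)%:R <= P.[eps^-1]
      & (* calls to f *)
      (calls_f tr)%:R <= P.[eps^-1]].
Proof.
(* The polynomial is fixed by [R] and [K] alone, before losses, oracles, [f] and [eps] are
   introduced. *)
exists (cost_polynomial R K) => C Cbar ell unif ellt M f tie eps _ _ unifP cube_ell assess.
move=> cases /andP[eps_gt0 eps_le1] out tr.
have [a_le o_le r_le c_le] := GroupOpt_costs f ellt M unif tie K_gt0 eps_gt0 eps_le1.
split=> //; last exact: GroupOpt_queries.
exact: GroupOpt_correct unifP cube_ell assess cases.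
Qed.
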